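(* Let $\mathfrak g$ be a reductive Lie algebra of rank $\ell$ with Cartan subalgebra $\mathfrak t$, let $\tilde{\mathfrak g}=\mathfrak g\dotplus\mathfrak t_{\sf dir}$ with the horospherical splitting $\tilde{\mathfrak g}=\tilde{\mathfrak h}\oplus\tilde{\mathfrak r}$ described in the context, let $F_1,\dots,F_\ell$ be a Hilbert basis of $\mathcal S(\mathfrak g)^{\mathfrak g}$ with $d_j=\deg F_j$, and let $\xi_1,\dots,\xi_\ell$ be a basis of $\mathfrak t_{\sf dir}$. Let $\boldsymbol f_j\in\mathcal S(\mathfrak t_{\sf dir})$ be the copy of $f_j=F_j|_{\mathfrak t}\in\mathcal S(\mathfrak t)$. Then (i) $\xi_1,\dots,\xi_\ell,\ F_1-\boldsymbol f_1,\dots,F_\ell-\boldsymbol f_\ell$ is a good generating system for $\tilde{\mathfrak h}$; (ii) $\xi_1,\dots,\xi_\ell,\ F_1-(-1)^{d_1}\boldsymbol f_1,\dots,F_\ell-(-1)^{d_\ell}\boldsymbol f_\ell$ is a good generating system for $\tilde{\mathfrak r}$.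
   Context: The ground field $\Bbbk$ is algebraically closed of characteristic $0$. $\mathfrak g=\mathfrak u_+\oplus\mathfrak t\oplus\mathfrak u_-$ is a fixed triangular decomposition. $\tilde{\mathfrak g}=\mathfrak g\dotplus\mathfrak t_{\sf dir}$ is the direct sum of Lie algebras, where $\mathfrak t_{\sf dir}$ is another copy of $\mathfrak t$ (with a fixed identification $\mathfrak t\simeq\mathfrak t_{\sf dir}$); $\mathrm{rk}\,\tilde{\mathfrak g}=2\ell$. In $\mathfrak t\dotplus\mathfrak t_{\sf dir}$ put $\mathfrak t_0=\{(t,t)\mid t\in\mathfrak t\}$ and $\mathfrak t_1=\{(t,-t)\mid t\in\mathfrak t\}$. Set $\tilde{\mathfrak h}=\mathfrak u_+\oplus\mathfrak t_1$ and $\tilde{\mathfrak r}=\mathfrak u_-\oplus\mathfrak t_0$; then $\tilde{\mathfrak g}=\tilde{\mathfrak h}\oplus\tilde{\mathfrak r}$. For $F\in\mathcal S(\mathfrak g)^{\mathfrak g}$, viewed as a polynomial on $\mathfrak g^*$, $f=F|_{\mathfrak t}\in\mathcal S(\mathfrak t)$ denotes its restriction to $\mathfrak t\simeq\mathfrak t^*=\mathrm{Ann}(\mathfrak u_+\oplus\mathfrak u_-)\subset\mathfrak g^*$, i.e., the image of $F$ under the homomorphism $\mathcal S(\mathfrak g)\to\mathcal S(\mathfrak t)$ that is the identity on $\mathfrak t$ and kills $\mathfrak u_+\oplus\mathfrak u_-$; $\boldsymbol f\in\mathcal S(\mathfrak t_{\sf dir})$ is the element corresponding to $f$ under the identification $\mathfrak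 t\simeq\mathfrak t_{\sf dir}$. A Hilbert basis of a graded polynomial ring is a set of algebraically independent homogeneous generators. $\mathcal S(\tilde{\mathfrak g})^{\tilde{\mathfrak g}}$ is a graded polynomial ring in $2\ell$ variables. For homogeneous $F\in\mathcal S^d(\tilde{\mathfrak g})$ write $F=\sum_iF_{i,d-i}$ with $F_{i,d-i}\in\mathcal S^i(\tilde{\mathfrak h})\otimes\mathcal S^{d-i}(\tilde{\mathfrak r})$; $F^\bullet$ (resp. $F_\bullet$) is the nonzero component of maximal $\tilde{\mathfrak r}$-degree (resp. maximal $\tilde{\mathfrak h}$-degree). A Hilbert basis $(E_k)_{k=1}^{2\ell}$ of $\mathcal S(\tilde{\mathfrak g})^{\tilde{\mathfrak g}}$ is a good generating system for $\tilde{\mathfrak h}$ (resp. for $\tilde{\mathfrak r}$) if the $E_k^\bullet$ (resp. the $(E_k)_\bullet$) are algebraically independent. *)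

(* Defs.v *)
From HB Require Import structures.
From mathcomp Require Import all_boot all_order all_algebra.
From mathcomp Require Export mpoly.

Set Implicit Arguments.
Unset Strict Implicit.
Unset Printing Implicit Defensive.

Import GRing.Theory.
Local Open Scope ring_scope.

HB.mixin Record Vector_isLieAlgebra (K : fieldType) L of Vector K L := {
  lie : L -> L -> L;
  lie_linearl : forall x, linear (lie^~ x);
  lie_linearr : forall x, linear (lie x);
  liexx : forall x, lie x x = 0;
  lie_jacobi : forall x y z,
    lie x (lie y z) + lie y (lie z x) + lie z (lie x y) = 0
}.

#[short(type="lieAlgType")]
HB.structure Definition LieAlgebra (K : fieldType) :=
  { L of Vector_isLieAlgebra K L & Vector K L }.

HB.instance Definition _ (K : fieldType) (g : lieAlgType K) (x : g) :=
  GRing.isLinear.Build K g g _ (lie x) (lie_linearr x).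

Definition lie_r (K : fieldType) (g : lieAlgType K) (y x : g) : g := lie x y.
HB.instance Definition _ (K : fieldType) (g : lieAlgType K) (y : g) :=
  GRing.isLinear.Build K g g _ (lie_r y) (lie_linearl y).

Definition ad (K : fieldType) (g : lieAlgType K) (x : g) : 'End(g) :=
  linfun (lie x).

Lemma adE (K : fieldType) (g : lieAlgType K) (x y : g) : ad x y = lie x y.
Proof. by rewrite lfunE. Qed.

Section ProdLie.
Variables (K : fieldType) (g1 g2 : lieAlgType K).
Local Notation P := (g1 * g2)%type.

Definition prod_lie (x y : P) : P := (lie x.1 y.1, lie x.2 y.2).

Fact prod_lie_linearl x : linear (prod_lie^~ x).
Proof. by move=> a y z; rewrite /prod_lie /= !lie_linearl. Qed.

Fact prod_lie_linearr x : linear (prod_lie x).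
Proof. by move=> a y z; rewrite /prod_lie /= !lie_linearr. Qed.

Fact prod_liexx x : prod_lie x x = 0.
Proof. by rewrite /prod_lie !liexx. Qed.

Fact prod_lie_jacobi x y z :
  prod_lie x (prod_lie y z) + prod_lie y (prod_lie z x)
    + prod_lie z (prod_lie x y) = 0.
Proof. by apply/eqP; rewrite xpair_eqE /= !lie_jacobi !eqxx. Qed.

HB.instance Definition _ := Vector_isLieAlgebra.Build K P
  prod_lie_linearl prod_lie_linearr prod_liexx prod_lie_jacobi.
End ProdLie.

Record lieSubalg (K : fieldType) (g : lieAlgType K) := LieSubalg {
  lieSubalg_vs :> {vspace g};
  lieSubalgP : {in lieSubalg_vs &, forall x y, lie x y \in lieSubalg_vs}
}.

Section SubLie.
Variables (K : fieldType) (g : lieAlgType K) (t : lieSubalg g).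

Definition lie_sub : Type := subvs_of t.
HB.instance Definition _ := Vector.on lie_sub.

Definition lie_sub_lie (x y : lie_sub) : lie_sub :=
  vsproj t (lie (vsval x) (vsval y)).

Lemma val_lie_sub_lie x y : vsval (lie_sub_lie x y) = lie (vsval x) (vsval y).
Proof. by rewrite vsprojK // lieSubalgP // subvsP. Qed.

Fact lie_sub_linearl x : linear (lie_sub_lie^~ x).
Proof.
move=> a y z; apply: val_inj.
rewrite [RHS]linearP /= !val_lie_sub_lie linearP /=; exact: lie_linearl.
Qed.

Fact lie_sub_linearr x : linear (lie_sub_lie x).
Proof.
move=> a y z; apply: val_inj.
by rewrite [RHS]linearP /= !val_lie_sub_lie !linearP.
Qed.

Fact lie_sub_liexx x : lie_sub_lie x x = 0.
Proof. by apply: val_inj; rewrite /= val_lie_sub_lie liexx. Qed.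

Fact lie_sub_jacobi x y z :
  lie_sub_lie x (lie_sub_lie y z) + lie_sub_lie y (lie_sub_lie z x)
    + lie_sub_lie z (lie_sub_lie x y) = 0.
Proof.
apply: val_inj.
by rewrite /= !val_lie_sub_lie lie_jacobi.
Qed.

HB.instance Definition _ := Vector_isLieAlgebra.Build K lie_sub
  lie_sub_linearl lie_sub_linearr lie_sub_liexx lie_sub_jacobi.
End SubLie.

Section LieTheory.
Variables (K : fieldType) (g : lieAlgType K).

Definition lie_ideal (I : {vspace g}) : Prop :=
  forall x y : g, y \in I -> lie x y \in I.

(* The adjoint representation is completely reducible. *)
Definition reductive : Prop :=
  forall I : {vspace g}, lie_ideal I ->
  exists J : {vspace g},
    [/\ lie_ideal J, (I + J)%VS = fullv & (I :&: J)%VS = 0%VS].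

Definition lie_prodv (U V : {vspace g}) : {vspace g} :=
  <<[seq lie x y | x <- vbasis U, y <- vbasis V]>>%VS.

Definition lie_nilpotent (U : {vspace g}) : Prop :=
  exists k, iter k (lie_prodv U) U = 0%VS.

Definition cartan_subalgebra (t : lieSubalg g) : Prop :=
  lie_nilpotent t /\
  (forall x : g, (forall h : g, h \in lieSubalg_vs t -> lie x h \in lieSubalg_vs t) ->
     x \in lieSubalg_vs t).

Variable t : lieSubalg g.
Local Notation weight := 'Hom(lie_sub t, K^o).

Definition rootspace (alpha : weight) : {vspace g} :=
  (\bigcap_(h <- vbasis {:lie_sub t}) passmx.leigenspace (ad (vsval h)) (alpha h))%VS.

Lemma rootspaceP (alpha : weight) (x : g) :
  reflect (forall h : lie_sub t, lie (vsval h) x = (alpha h : K) *: x)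
          (x \in rootspace alpha).
Proof.
have inE h : (x \in passmx.leigenspace (ad (vsval h)) (alpha h)) =
             (lie (vsval h) x == (alpha h : K) *: x).
  by rewrite memv_ker add_lfunE opp_lfunE scale_lfunE id_lfunE adE subr_eq0.
have -> : (x \in rootspace alpha) =
    all (fun h => lie (vsval h) x == (alpha h : K) *: x) (vbasis {:lie_sub t}).
  rewrite /rootspace; elim: (tval (vbasis _)) => [|h s IHs].
    by rewrite big_nil memvf.
  by rewrite big_cons memv_cap IHs inE.
apply: (iffP allP) => [eig h | eig h _]; last by rewrite eig.
rewrite (coord_vbasis (memvf h)).
apply: (big_ind (fun h => lie (vsval h) x = (alpha h : K) *: x)).
- by rewrite [alpha 0]linear0 scale0r; apply: (linear0 (lie_r x)).
- move=> h1 h2 e1 e2; rewrite [alpha _]linearD scalerDl -e1 -e2.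
  exact: (linearD (lie_r x)).
move=> i _; rewrite [alpha _]linearZ /= -scalerA.
have /eqP <- : lie (vsval (vbasis {:lie_sub t})`_i) x
    == (alpha (vbasis {:lie_sub t})`_i : K) *: x.
  by apply: eig; rewrite mem_nth // size_tuple.
exact: (linearZ_LR (lie_r x)).
Qed.

Definition is_root (alpha : weight) : bool :=
  (alpha != 0) && (rootspace alpha != 0%VS).

Definition positive_system (Dp : seq weight) : Prop :=
  [/\ uniq Dp,
      {in Dp, forall alpha, is_root alpha},
      forall alpha, is_root alpha -> (alpha \in Dp) (+) (- alpha \in Dp)
    & {in Dp &, forall alpha beta,
        is_root (alpha + beta) -> alpha + beta \in Dp}].

Definition triangular_decomposition (up um : {vspace g}) : Prop :=
  exists Dp : seq weight,
    [/\ positive_system Dp,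
        up = (\sum_(alpha <- Dp) rootspace alpha)%VS,
        um = (\sum_(alpha <- Dp) rootspace (- alpha))%VS,
        (up + t + um)%VS = fullv
      & directv (up + t + um)].

End LieTheory.

Section SymmetricAlgebra.
Variables (K : fieldType) (V : vectType K).

(* S(V) is the polynomial algebra whose variables are the vectors of the
   standard basis [vbasis fullv] of V. *)
Definition symalg := {mpoly K[\dim {:V}]}.

Definition sym_inj (v : V) : symalg :=
  \sum_(i < \dim {:V}) coord (vbasis {:V}) i v *: 'X_i.

Fact sym_inj_linear : linear sym_inj.
Proof.
move=> a x y; rewrite /sym_inj scaler_sumr -big_split /=.
by apply: eq_bigr => i _; rewrite linearP scalerDl scalerA.
Qed.
HB.instance Definition _ := GRing.isLinear.Build K V symalg _ sym_inj sym_inj_linear.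

Definition alg_independent m (E : m.-tuple symalg) : Prop :=
  forall P : {mpoly K[m]}, P \mPo E = 0 -> P = 0.

(* The subspace S^i(h) (x) S^j(r) of S(V), spanned by the products of i
   vectors of h and j vectors of r. *)
Definition bigraded_part (h r : {vspace V}) (i j : nat) (F : symalg) : Prop :=
  exists (N : nat) (c : 'I_N -> K)
         (a : 'I_N -> i.-tuple (subvs_of h)) (b : 'I_N -> j.-tuple (subvs_of r)),
    F = \sum_(k < N) c k *: ((\prod_(v <- a k) sym_inj (vsval v)) *
                             (\prod_(w <- b k) sym_inj (vsval w))).

(* For F homogeneous and V = h (+) r: G is the nonzero bihomogeneous component
   of F of maximal degree in r. *)
Definition max_component (h r : {vspace V}) (F G : symalg) : Prop :=
  exists (d : nat) (C : nat -> symalg) (j : nat),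
    [/\ forall i, (i <= d)%N -> bigraded_part h r (d - i) i (C i),
        F = \sum_(i < d.+1) C i,
        (j <= d)%N /\ C j = G,
        G != 0
      & forall i, (j < i <= d)%N -> C i = 0].

End SymmetricAlgebra.

(* The algebra homomorphism S(V) -> S(W) induced by a linear map V -> W. *)
Definition sym_map (K : fieldType) (V W : vectType K) (phi : V -> W)
    (F : symalg V) : symalg W :=
  F \mPo [tuple sym_inj (phi (tnth (vbasis {:V}) i)) | i < \dim {:V}].

Lemma sym_map_inj (K : fieldType) (V W : vectType K) (phi : {linear V -> W})
    (v : V) : sym_map phi (sym_inj v) = sym_inj (phi v).
Proof.
rewrite /sym_map {1}/sym_inj linear_sum /= [in RHS](coord_vbasis (memvf v)).
rewrite !linear_sum; apply: eq_bigr => i _ /=.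
by rewrite comp_mpolyZ comp_mpolyXU -!tnth_nth tnth_mktuple !linearZ.
Qed.

Section Invariants.
Variables (K : fieldType) (g : lieAlgType K).

(* The derivation of S(g) extending ad x. *)
Definition sym_ad (x : g) (F : symalg g) : symalg g :=
  \sum_(i < \dim {:g}) sym_inj (lie x (tnth (vbasis {:g}) i)) * F^`M(i).

Lemma sym_ad_inj (x y : g) : sym_ad x (sym_inj y) = sym_inj (lie x y).
Proof.
rewrite /sym_ad [in RHS](coord_vbasis (memvf y)) !linear_sum /=.
apply: eq_bigr => i _; rewrite !linearZ /= -(tnth_nth 0).
have -> : (sym_inj y)^`M(i) = (coord (vbasis {:g}) i y)%:MP.
  rewrite /sym_inj linear_sum (bigD1 i) //= big1 => [|j ne_ji].
    rewrite addr0 mderivZ mderivX mnm1E eqxx scale1r (_ : (_ - _)%MM = 0%MM).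
      by rewrite mpolyX0 alg_mpolyC.
    by apply/mnmP=> j; rewrite mnmBE subnn mnm0E.
  by rewrite mderivZ mderivX mnm1E (negPf ne_ji) scale0r scaler0.
by rewrite mulrC mul_mpolyC.
Qed.

Lemma sym_adM (x : g) (F G : symalg g) :
  sym_ad x (F * G) = sym_ad x F * G + F * sym_ad x G.
Proof.
rewrite /sym_ad mulr_suml mulr_sumr -big_split /=; apply: eq_bigr => i _.
by rewrite mderivM mulrDr [X in _ + X = _]mulrCA -!mulrA.
Qed.

Definition sym_invariant (F : symalg g) : Prop := forall x, sym_ad x F = 0.

(* E is a Hilbert basis of S(g)^g. *)
Definition hilbert_basis m (E : m.-tuple (symalg g)) : Prop :=
  [/\ forall k, sym_invariant (tnth E k),
      forall k, exists d, tnth E k \is d.-homog,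
      alg_independent E
    & forall F, sym_invariant F -> exists P : {mpoly K[m]}, F = P \mPo E].

(* E is a good generating system for h, where g = h (+) r as vector spaces. *)
Definition good_generating_system (h r : {vspace g}) m
    (E : m.-tuple (symalg g)) : Prop :=
  hilbert_basis E /\
  exists T : m.-tuple (symalg g),
    (forall k, max_component h r (tnth E k) (tnth T k)) /\ alg_independent T.

End Invariants.

Section Horospherical.
Variables (K : fieldType) (g : lieAlgType K) (t : lieSubalg g).
Variables (up um : {vspace g}).

(* t_dir is realised as the Lie algebra [lie_sub t]. *)
Definition gtilde : lieAlgType K := (g * lie_sub t)%type.

Definition emb_g (x : g) : gtilde := (x, 0).
Definition emb_dir (a : lie_sub t) : gtilde := (0, a).
Definition diag_t (a : lie_sub t) : gtilde := (vsval a, a).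
Definition antidiag_t (a : lie_sub t) : gtilde := (vsval a, - a).

Fact emb_g_linear : linear emb_g.
Proof.
by move=> a x y; apply/eqP; rewrite xpair_eqE /= scaler0 addr0 !eqxx.
Qed.
HB.instance Definition _ :=
  GRing.isLinear.Build K g gtilde _ emb_g emb_g_linear.

Fact emb_dir_linear : linear emb_dir.
Proof.
by move=> a x y; apply/eqP; rewrite xpair_eqE /= scaler0 addr0 !eqxx.
Qed.
HB.instance Definition _ :=
  GRing.isLinear.Build K (lie_sub t) gtilde _ emb_dir emb_dir_linear.

Fact diag_t_linear : linear diag_t.
Proof. by move=> a x y; apply/eqP; rewrite xpair_eqE /= !eqxx. Qed.
HB.instance Definition _ :=
  GRing.isLinear.Build K (lie_sub t) gtilde _ diag_t diag_t_linear.

Fact antidiag_t_linear : linear antidiag_t.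
Proof.
move=> a x y; apply/eqP.
by rewrite xpair_eqE /= opprD scalerN !eqxx.
Qed.
HB.instance Definition _ :=
  GRing.isLinear.Build K (lie_sub t) gtilde _ antidiag_t antidiag_t_linear.

Definition t0 : {vspace gtilde} := limg (linfun diag_t).
Definition t1 : {vspace gtilde} := limg (linfun antidiag_t).
Definition htilde : {vspace gtilde} := (linfun emb_g @: up + t1)%VS.
Definition rtilde : {vspace gtilde} := (linfun emb_g @: um + t0)%VS.

(* The projection g -> t along u_+ (+) u_-. *)
Definition proj_t (x : g) : lie_sub t := vsproj t (daddv_pi t (up + um) x).

(* The restriction F |-> F|_t from S(g) to S(t), with S(t) realised as
   [symalg (lie_sub t)]. *)
Definition restr_t (F : symalg g) : symalg (lie_sub t) := sym_map proj_t F.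

Definition sym_emb_g (F : symalg g) : symalg gtilde := sym_map emb_g F.

(* The copy in S(t_dir), inside S(gtilde), of F|_t. *)
Definition bold_f (F : symalg g) : symalg gtilde :=
  sym_map emb_dir (restr_t F).

End Horospherical.

(* Main.v *)
(* The restrictions f_j are algebraically independent because restriction to t
   is injective on invariants; hence their Jacobian determinant is non-zero.
   An invariant F, restricted to the opposite Borel subalgebra t + u_-, only
   depends on t.  Hence, in the bigrading by htilde and rtilde, the component
   of htilde-degree 0 of F minus its copy of f vanishes, and the derivative
   along t_1 of the component of htilde-degree 1 is twice the gradient of f
   evaluated on t_0.  So the Jacobian matrix of the components of the xi_i and
   the F_j - f_j is block triangular with non-zero determinant.  Part (ii) is
   part (i) with u_+ and u_- exchanged and t_dir twisted by -1, which is the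
   role of the sign eps.

   Both facts on invariants have the same infinitesimal proof.  Let F_n be the
   lowest non-zero component of F of positive degree in the root vectors.  For
   a root vector x, invariance under ad x shows that the derivation sending a
   root vector y to the t-component of [x, y] kills F_n.  That component is
   the Killing form of x and y times a fixed coroot, and the Killing form is
   non-degenerate on the root spaces, so every derivative of F_n along a root
   vector vanishes and Euler's identity gives F_n = 0.  The non-degeneracy is
   Cartan's criterion: the weights are rational multiples of each other on a
   coroot, so a coroot in the radical has all weights zero, hence is central. *)
Require Import Defs.
From HB Require Import structures.
From mathcomp Require Import all_boot all_order all_algebra.

Set Implicit Arguments.
Unset Strict Implicit.
Unset Printing Implicit Defensive.

Import GRing.Theory.
Local Open Scope ring_scope.

(** * Derivations of polynomial rings and the Jacobian criterion *)

Section Derivations.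
Variables (K : fieldType) (n : nat) (C : comNzRingType).
Local Notation A := {mpoly K[n]}.

(** The components are reached without a basis adapted to the splitting. Given complementary
    projections [p] and [q], substituting [p + X q] for the identity turns the bihomogeneous
    components of F into the coefficients of a polynomial in X. Invariance, Euler's identity and
    differentiation then become equalities between derivations along one ring morphism, and these
    need only be checked on vectors. Root spaces are not known here to be one-dimensional. Coroots
    are therefore replaced by root vectors x_i dual to the basis b_k for the Killing form: the torus
    part of [x_i, b_k] is delta_ik h_i with h_i non-zero. Jacobians are used in both directions. A
    non-zero determinant gives the independence of components and generators; the converse, applied
    to the f_j, rests on an algebraic relation between each variable and n given polynomials. That
    the proposed systems generate all invariants is a separate matter: g commutes with t_dir, so the
    coefficients of an invariant in the coordinates of t_dir are invariants of g. *)

Lemma mpoly_gen_ind (P : A -> Prop) :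
  (forall c, P c%:MP) -> (forall i, P 'X_i) ->
  (forall F G, P F -> P G -> P (F + G)) ->
  (forall F G, P F -> P G -> P (F * G)) -> forall F, P F.
Proof.
move=> PC PX PD PM; apply: mpolyind => [|c m p _ _ Pp].
  by rewrite -mpolyC0; apply: PC.
apply: PD Pp; rewrite -mul_mpolyC; apply: (PM); first exact: PC.
rewrite mpolyXE_id; apply: (big_ind P) => [||i _]; [by rewrite -mpolyC1; apply: PC|exact: (PM)|].
elim: (m i) => [|k IHk]; first by rewrite expr0 -mpolyC1; apply: PC.
by rewrite exprS; apply: PM.
Qed.

Lemma rmorph_mpoly_eq (f g : {rmorphism A -> C}) :
  (forall c, f c%:MP = g c%:MP) -> (forall i, f 'X_i = g 'X_i) -> f =1 g.
Proof.
move=> fgC fgX; apply: mpoly_gen_ind => // F G eF eG.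
- by rewrite !rmorphD eF eG.
- by rewrite !rmorphM eF eG.
Qed.

(** The twist by [phi] lets derivations be composed with substitutions and pencils. Two of them over
    the same [phi] are compared on the variables alone, which settles most identities below. *)
Definition derivation_along (phi D : A -> C) : Prop :=
  [/\ forall F G, D (F + G) = D F + D G,
      forall F G, D (F * G) = D F * phi G + phi F * D G
    & forall c, D c%:MP = 0].

Lemma derivation_along_eq (phi D1 D2 : A -> C) :
  derivation_along phi D1 -> derivation_along phi D2 ->
  (forall i, D1 'X_i = D2 'X_i) -> D1 =1 D2.
Proof.
move=> [D1D D1M D1C] [D2D D2M D2C] e; apply: mpoly_gen_ind => //.
- by move=> c; rewrite D1C D2C.
- by move=> F G eF eG; rewrite D1D D2D eF eG.
- by move=> F G eF eG; rewrite D1M D2M eF eG.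
Qed.

Lemma derivation_sum_mderiv (phi : {rmorphism A -> C}) (psi : 'I_n -> C) :
  derivation_along phi (fun F => \sum_i psi i * phi F^`M(i)).
Proof.
split=> [F G|F G|c].
- rewrite -big_split; apply: eq_bigr => i _.
  by rewrite mderivD rmorphD mulrDr.
- rewrite mulr_suml mulr_sumr -big_split; apply: eq_bigr => i _ /=.
  by rewrite mderivM rmorphD !rmorphM mulrDr mulrA [X in _ + X]mulrCA.
- by rewrite big1 // => i _; rewrite mderivC rmorph0 mulr0.
Qed.

Lemma mderivXU (i j : 'I_n) : ('X_j : A)^`M(i) = (i == j)%:R.
Proof.
rewrite mderivX mnm1E eq_sym; case: eqVneq => [->|_]; last by rewrite scale0r.
by rewrite scale1r (_ : (_ - _)%MM = 0%MM) ?mpolyX0 //;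
   apply/mnmP=> k; rewrite mnmBE subnn mnm0E.
Qed.

Lemma derivation_alongE (phi : {rmorphism A -> C}) (D : A -> C) :
  derivation_along phi D ->
  forall F, D F = \sum_i D 'X_i * phi F^`M(i).
Proof.
move=> dD; apply: (derivation_along_eq dD (derivation_sum_mderiv phi _)) => i.
rewrite (bigD1 i) //= big1 => [|j ne_ji].
  by rewrite mderivXU eqxx rmorph1 mulr1 addr0.
by rewrite mderivXU (negPf ne_ji) rmorph0 mulr0.
Qed.

End Derivations.

Section ChainRule.
Variables (K : fieldType) (n m : nat) (C : comNzRingType).
Variables (phi : {rmorphism {mpoly K[n]} -> C}) (D : {mpoly K[n]} -> C).
Hypothesis dD : derivation_along phi D.

Lemma derivation_comp (E : m.-tuple {mpoly K[n]}) (P : {mpoly K[m]}) :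
  D (P \mPo E) = \sum_j D (tnth E j) * phi (P^`M(j) \mPo E).
Proof.
have [DD DM DC] := dD.
have dDE : derivation_along (phi \o comp_mpoly E) (D \o comp_mpoly E).
  split=> [F G|F G|c] /=.
  - by rewrite rmorphD DD.
  - by rewrite rmorphM DM.
  - by rewrite comp_mpolyC DC.
have := derivation_alongE dDE P; rewrite /= => ->.
by apply: eq_bigr => j _; rewrite comp_mpolyXU -tnth_nth.
Qed.

End ChainRule.

Section JacobianCriterion.
Variable K : fieldType.
Hypothesis K0 : [pchar K] =i pred0.

Let natK_eq0 k : (k%:R == 0 :> K) = (k == 0)%N.
Proof. by move: k; apply/pcharf0P. Qed.

Lemma mderiv_eq0_const n (P : {mpoly K[n]}) :
  (forall i, P^`M(i) = 0) -> P = (P@_0)%:MP.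
Proof.
move=> dP; apply/mpolyP => m; rewrite mcoeffC.
case: eqVneq => [-> | ne_m0]; first by rewrite mulr1.
rewrite mulr0.
have [i mi] : exists i, m i != 0%N.
  apply/existsP; rewrite -negb_forall; apply: contra ne_m0 => /forallP m0.
  by apply/eqP/mnmP=> i; rewrite mnm0E; apply/eqP/m0.
have := congr1 (mcoeff (m - U_(i))) (dP i).
rewrite mcoeff_mderiv mcoeff0.
have -> : (m - U_(i) + U_(i))%MM = m.
  apply/mnmP=> j; rewrite mnmDE mnmBE mnm1E; case: eqVneq => [<-|_].
    by rewrite subnK // lt0n.
  by rewrite subn0 addn0.
by move/eqP; rewrite -mulr_natr mulf_eq0 natK_eq0 orbF => /eqP.
Qed.

Lemma msize_mderiv_lt n (P : {mpoly K[n]}) i : P != 0 ->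
  (msize P^`M(i) < msize P)%N.
Proof.
move=> nzP; have [->|nzd] := eqVneq P^`M(i) 0.
  by rewrite msize0 lt0n msize_poly_eq0.
rewrite -(mlead_deg nzd).
have : mlead P^`M(i) \in msupp P^`M(i) by rewrite mlead_supp.
rewrite mcoeff_msupp mcoeff_mderiv => h.
have : (mlead P^`M(i) + U_(i))%MM \in msupp P.
  by rewrite mcoeff_msupp; apply: contraNneq h => ->; rewrite mul0rn.
by move/msize_mdeg_lt; rewrite mdegD mdeg1 addn1.
Qed.

(** The rows are arbitrary derivations, so that they can be adapted to the splitting. By the chain
    rule the gradient of a relation, evaluated at [E], is a kernel vector of the Jacobian matrix; so
    every partial derivative of a relation is a smaller relation. *)
Lemma jacobian_independent n m (E : m.-tuple {mpoly K[n]})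
    (D : 'I_m -> {mpoly K[n]} -> {mpoly K[n]}) :
  (forall k, derivation_along idfun (D k)) ->
  \det (\matrix_(i, j) D i (tnth E j)) != 0 ->
  forall P : {mpoly K[m]}, P \mPo E = 0 -> P = 0.
Proof.
move=> dD nzJ P; move: {2}(msize P) (leqnn (msize P)) => k.
elim: k P => [|k IHk] P leP PE.
  by apply/eqP; rewrite -msize_poly_eq0 -leqn0.
have [//|nzP] := eqVneq P 0.
have dP i : P^`M(i) = 0.
  apply: IHk; first by rewrite -ltnS; apply: leq_trans leP; rewrite msize_mderiv_lt.
  pose v : 'rV_m := \row_j (P^`M(j) \mPo E).
  have vJ : v *m (\matrix_(i, j) D i (tnth E j))^T = 0.
    apply/rowP => a; rewrite !mxE.
    have [DD _ DC] := dD a.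
    transitivity (D a (P \mPo E)); last by rewrite PE -mpolyC0 DC.
    have /= := derivation_comp (phi := idfun) (dD a) E P; move=> ->.
    by apply: eq_bigr => j _; rewrite !mxE mulrC.
  have [v0|nzv] := eqVneq v 0; first by have /rowP/(_ i) := v0; rewrite !mxE.
  by case/negP: nzJ; rewrite -det_tr; apply/det0P; exists v.
move: PE; rewrite (mderiv_eq0_const dP) comp_mpolyC => /eqP.
by rewrite mpolyC_eq0 => /eqP ->; rewrite mpolyC0.
Qed.

End JacobianCriterion.

(** * Algebraic relations by dimension count, and the converse Jacobian criterion *)

Section Annihilator.
Variables (K : fieldType) (n : nat).
Local Notation A := {mpoly K[n]}.

Lemma msize_exp_mul_le (q r : A) k :
  (msize (q ^+ k * r) <= msize r + k * (msize q).+1)%N.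
Proof.
elim: k r => [|k IHk] r; first by rewrite expr0 mul1r mul0n addn0.
rewrite exprSr -mulrA.
apply: leq_trans (IHk _) _; rewrite mulSn addnA leq_add2r addnS.
by rewrite addnC msizeM_le.
Qed.

(** A count of monomials: the products of powers of [p] and of the n entries of [f] with exponents
    below N number N^(n+1). They lie in the span of (N c)^n monomials, which is fewer because N
    exceeds c^n. *)
Lemma exists_annihilator (p : A) (f : n.-tuple A) :
  exists P : {poly A}, P != 0 /\ (map_poly (comp_mpoly f) P).[p] = 0.
Proof.
(* Raising every exponent by one adds at most [w] to the size, so exponents up to N - 1 give size at
   most 1 + (N - 1) w, hence at most M. *)
pose w := ((msize p).+1 + \sum_j (msize (tnth f j)).+1)%N.
pose c := w.+1; pose N := (c ^ n).+1; pose M := (N * c)%N.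
pose I := ('I_N * {ffun 'I_n -> 'I_N})%type.
pose J := {ffun 'I_n -> 'I_M}.
pose mon k (m : {ffun 'I_n -> 'I_k}) : 'X_{1..n} := [multinom (m j : nat) | j < n].
pose q (i : I) := p ^+ i.1 * \prod_j tnth f j ^+ i.2 j.
have size_q i : (msize (q i) <= M)%N.
  rewrite /q; apply: leq_trans (msize_exp_mul_le _ _ _) _.
  have le_i (k : 'I_N) : (k <= N.-1)%N by rewrite -ltnS.
  apply: (@leq_trans (1 + N.-1 * w)); last first.
    by rewrite /M /c mulnS; apply: leq_add => //; apply: leq_mul => //; apply: leq_pred.
  rewrite /w mulnDr addnC addnCA; apply: leq_add; first exact: leq_mul.
  rewrite big_distrr /=.
  elim/big_rec2: _ => [|j s P _ IH]; first by rewrite msize1.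
  apply: leq_trans (msize_exp_mul_le _ _ _) _.
  by rewrite addnCA addnC; apply: leq_add => //; apply: leq_mul.
pose Q := \matrix_(i < #|{: I}|, j < #|{: J}|) (q (enum_val i))@_(mon _ (enum_val j)).
have [v nz_v vQ] : exists2 v : 'rV_#|{: I}|, v != 0 & v *m Q = 0.
  have : kermx Q != 0.
    rewrite kermx_eq0; apply/negP => /eqP rQ.
    have := rank_leq_col Q; rewrite rQ !card_prod !card_ffun !card_ord.
    by rewrite leqNgt expnMn [(N * _)%N]mulnC ltn_pmul2l ?expn_gt0 // ltnSn.
  by case/rowV0Pn=> v /sub_kermxP vQ nz_v; exists v.
pose P : {poly A} :=
  \sum_(i < #|{: I}|) (v 0 i *: 'X_[mon _ (enum_val i).2]) *: 'X^((enum_val i).1).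
exists P; split.
  apply: contraNneq nz_v => P0; apply/eqP/rowP => i; rewrite mxE.
  have := congr1 (fun R => mcoeff (mon N (enum_val i).2) (nth 0 (polyseq R) (enum_val i).1)) P0.
  rewrite coef0 mcoeff0 coef_sum raddf_sum (bigD1 i) //= big1 => [|j ne_ji].
    by rewrite coefZ coefXn eqxx mulr1 mcoeffZ mcoeffX eqxx mulr1 addr0.
  rewrite coefZ coefXn; case: eqP => [e1|]; last by rewrite mulr0 mcoeff0.
  rewrite mulr1 mcoeffZ mcoeffX; case: eqP => [e2|]; last by rewrite mulr0.
  case/eqP: ne_ji; apply: enum_val_inj.
  apply/eqP; rewrite -pair_eqE /pair_eq -(inj_eq val_inj) /= e1 eqxx /=.
  apply/eqP/ffunP=> k; apply: val_inj.
  by move/mnmP/(_ k): e2; rewrite !mnmE.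
have -> : (map_poly (comp_mpoly f) P).[p] = \sum_i v 0 i *: q (enum_val i).
  rewrite rmorph_sum horner_sum; apply: eq_bigr => i _ /=.
  rewrite map_polyZ /= map_polyXn hornerZ hornerXn linearZ /= comp_mpolyX.
  rewrite -scalerAl /q mulrC; congr (_ *: (_ * _)).
  by apply: eq_bigr => j _; rewrite mnmE.
apply/mpolyP => m; rewrite mcoeff0 raddf_sum /=.
have [/forallP le_m|] := boolP [forall j, (m j < M)%N].
  pose j : J := [ffun j => Ordinal (le_m j)].
  transitivity ((v *m Q) 0 (enum_rank j)); last by rewrite vQ mxE.
  rewrite mxE; apply: eq_bigr => i _; rewrite mxE mcoeffZ enum_rankK; congr (_ * _@_ _).
  by apply/mnmP=> k; rewrite mnmE ffunE.
rewrite negb_forall => /existsP[j]; rewrite -leqNgt => le_Mm.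
apply: big1 => i _; rewrite mcoeffZ memN_msupp_eq0 ?mulr0 //.
apply: msize_mdeg_ge; apply: leq_trans (size_q _) _.
by apply: leq_trans le_Mm _; rewrite mdegE (bigD1 j) // leq_addr.
Qed.

End Annihilator.

Section JacobianNonzero.
Variables (K : fieldType) (n : nat).
Hypothesis K0 : [pchar K] =i pred0.
Local Notation A := {mpoly K[n]}.

Lemma natr_mpoly_eq0 k : ((k%:R : A) == 0) = (k == 0)%N.
Proof.
rewrite -(rmorph_nat (@mpolyC n K)) mpolyC_eq0.
by move: k; apply/pcharf0P.
Qed.

(* An annihilator of ['X_i] over [K[f]] of minimal degree is separable, so a
   vector field that kills [f] kills every ['X_i]. *)
Lemma jacobian_neq0 (f : n.-tuple A) :
  (forall P : {mpoly K[n]}, P \mPo f = 0 -> P = 0) ->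
  \det (\matrix_(i < n, j < n) (tnth f j)^`M(i)) != 0.
Proof.
move=> indep; apply/negP => /det0P[v nz_v vJ].
pose D (F : A) := \sum_i v 0 i * F^`M(i).
have [DD DM DC] : derivation_along idfun D := derivation_sum_mderiv idfun _.
have Df (c : {mpoly K[n]}) : D (c \mPo f) = 0.
  rewrite (derivation_comp (phi := idfun) (And3 DD DM DC)) big1 // => j _.
  have /rowP/(_ j) := vJ; rewrite !mxE => vJj.
  rewrite [D _](_ : _ = 0) ?mul0r // -[RHS]vJj.
  by apply: eq_bigr => i _; rewrite mxE.
have [i nz_vi] : exists i, v 0 i != 0.
  apply/existsP; rewrite -negb_forall; apply: contra nz_v => /forallP v0.
  by apply/eqP/rowP => i; rewrite mxE; apply/eqP/v0.
have DX : D 'X_i = v 0 i.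
  rewrite /D (bigD1 i) //= big1 => [|j ne_ji]; rewrite mderivXU ?eqxx ?mulr1 ?addr0 //.
  by rewrite (negPf ne_ji) mulr0.
pose ev (P : {poly A}) := (map_poly (comp_mpoly f) P).[ 'X_i ].
have D_ev P : D (ev P) = ev P^`() * v 0 i.
  elim/poly_ind: P => [|P c IHP].
    by rewrite deriv0 /ev rmorph0 horner0 mul0r -mpolyC0 DC.
  have ev_step Q e : ev (Q * 'X + e%:P) = ev Q * 'X_i + (e \mPo f).
    by rewrite /ev rmorphD rmorphM /= map_polyX map_polyC hornerD hornerMX hornerC.
  rewrite ev_step DD Df addr0 DM DX IHP /= derivD derivC addr0 derivM derivX mulr1.
  by rewrite /ev rmorphD rmorphM /= map_polyX hornerD hornerMX mulrDl mulrAC.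
have [P [nzP evP]] := exists_annihilator 'X_i f.
move: {2}(size P) (leqnn (size P)) => k.
elim: k P nzP evP => [|k IHk] P nzP evP leP.
  by case/negP: nzP; rewrite -size_poly_leq0.
(* A non-zero derivative is again an annihilator, of smaller size. A zero derivative makes [P]
   constant, hence a relation between the entries of [f] alone. *)
have [dP0|nz_dP] := eqVneq P^`() 0; last first.
  apply: (IHk P^`()) => //; last by rewrite -ltnS (leq_trans (lt_size_deriv nzP)).
  have /eqP := D_ev P; rewrite [ev P]evP -mpolyC0 DC eq_sym mulf_eq0 (negPf nz_vi) orbF.
  by rewrite mpolyC0 => /eqP.
have /size1_polyC PC : (size P <= 1)%N.
  apply/leq_sizeP => -[//|j] _.
  have /eqP := congr1 (fun Q : {poly A} => Q`_j) dP0.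
  by rewrite coef_deriv coef0 -mulr_natr mulf_eq0 natr_mpoly_eq0 orbF => /eqP.
case/negP: nzP; move: evP; rewrite PC map_polyC hornerC /= => /indep ->.
by rewrite polyC0.
Qed.

End JacobianNonzero.

(** * Symmetric algebras *)

Section SymmetricAlgebraTheory.
Variables (K : fieldType) (V : vectType K).
Local Notation A := (symalg V).

Lemma sym_inj_vbasis i : sym_inj (tnth (vbasis {:V}) i) = 'X_i.
Proof.
have free_b := basis_free (vbasisP {:V}).
rewrite /sym_inj (bigD1 i) //= big1 => [|j ne_ji].
  by rewrite (tnth_nth 0) coord_free // eqxx scale1r addr0.
by rewrite (tnth_nth 0) coord_free // eq_sym (negPf ne_ji) scale0r.
Qed.

Lemma sym_inj_eq0 (v : V) : (sym_inj v == 0 :> A) = (v == 0).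
Proof.
apply/eqP/eqP => [v0|->]; last exact: linear0.
rewrite (coord_vbasis (memvf v)) big1 // => i _.
have := congr1 (mcoeff U_(i)) v0; rewrite mcoeff0 /sym_inj raddf_sum (bigD1 i) //=.
rewrite big1 => [|j ne_ji].
  by rewrite mcoeffZ mcoeffX eqxx mulr1 addr0 => ->; rewrite scale0r.
rewrite mcoeffZ mcoeffX (_ : (U_(j) == U_(i))%MM = false) ?mulr0 //.
apply/negP => /eqP/mnmP/(_ j); rewrite !mnm1E eqxx eq_sym.
by rewrite (negPf ne_ji).
Qed.

Lemma symalg_ind (P : A -> Prop) :
  (forall c, P c%:MP) -> (forall v, P (sym_inj v)) ->
  (forall F G, P F -> P G -> P (F + G)) ->
  (forall F G, P F -> P G -> P (F * G)) -> forall F, P F.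
Proof.
move=> PC PV PD PM; apply: mpoly_gen_ind => // i.
by rewrite -sym_inj_vbasis.
Qed.

Lemma symalg_rmorph_eq (C : comNzRingType) (f g : {rmorphism A -> C}) :
  (forall c, f c%:MP = g c%:MP) ->
  (forall v, f (sym_inj v) = g (sym_inj v)) -> f =1 g.
Proof. by move=> fgC fgV; apply: rmorph_mpoly_eq => // i; rewrite -sym_inj_vbasis. Qed.

Lemma symalg_derivation_eq (C : comNzRingType) (phi D1 D2 : A -> C) :
  derivation_along phi D1 -> derivation_along phi D2 ->
  (forall v, D1 (sym_inj v) = D2 (sym_inj v)) -> D1 =1 D2.
Proof.
by move=> d1 d2 e; apply: derivation_along_eq d1 d2 _ => i; rewrite -sym_inj_vbasis.
Qed.

Section Extension.
Variables (C : comNzRingType) (iota : {rmorphism K -> C}) (psi : V -> C).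
Hypothesis psi_lin : forall a u v, psi (a *: u + v) = iota a * psi u + psi v.

Let psi0 : psi 0 = 0.
Proof.
by have := psi_lin (-1) 0 0; rewrite scaler0 add0r rmorphN1 mulN1r addNr.
Qed.

Lemma semilinear_coord v :
  psi v = \sum_i iota (coord (vbasis {:V}) i v) * psi (tnth (vbasis {:V}) i).
Proof.
rewrite {1}(coord_vbasis (memvf v)); elim/big_rec2: _ => [|i y1 y2 _ <-]; first exact: psi0.
by rewrite psi_lin -tnth_nth.
Qed.

(** The universal property of S(V). Scalars may enter C through any morphism [iota], so that C can
    be a polynomial ring over another symmetric algebra. *)
Definition sym_ext : A -> C := mmap iota (fun i => psi (tnth (vbasis {:V}) i)).

HB.instance Definition _ := GRing.RMorphism.copy sym_ext (mmap iota _).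

Lemma sym_extC c : sym_ext c%:MP = iota c.
Proof. exact: mmapC. Qed.

Lemma sym_ext_inj v : sym_ext (sym_inj v) = psi v.
Proof.
rewrite semilinear_coord /sym_inj rmorph_sum; apply: eq_bigr => i _ /=.
by rewrite /sym_ext mmapZ mmapX mmap1U.
Qed.

End Extension.

Section Derivation.
Variables (C : comNzRingType) (phi : {rmorphism A -> C}) (psi : V -> C).

Definition sym_der (F : A) : C :=
  \sum_i psi (tnth (vbasis {:V}) i) * phi F^`M(i).

Lemma sym_der_derivation : derivation_along phi sym_der.
Proof. exact: derivation_sum_mderiv. Qed.

Hypothesis psi_lin :
  forall a u v, psi (a *: u + v) = phi a%:MP * psi u + psi v.

Lemma sym_der_inj v : sym_der (sym_inj v) = psi v.
Proof.
rewrite (semilinear_coord (iota := phi \o @mpolyC _ K) psi_lin v).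
rewrite /sym_der; apply: eq_bigr => i _; rewrite mulrC; congr (_ * _) => /=.
rewrite /sym_inj linear_sum (bigD1 i) //= big1 => [|j ne_ji].
  by rewrite mderivZ mderivXU eqxx addr0 -mul_mpolyC mulr1.
by rewrite mderivZ mderivXU eq_sym (negPf ne_ji) scaler0.
Qed.

End Derivation.

End SymmetricAlgebraTheory.

Section SymMap.
Variables (K : fieldType) (V W : vectType K).

HB.instance Definition _ (phi : V -> W) :=
  GRing.RMorphism.copy (sym_map phi)
    (comp_mpoly [tuple sym_inj (phi (tnth (vbasis {:V}) i)) | i < \dim {:V}]).

Lemma sym_mapC (phi : V -> W) c : sym_map phi c%:MP = c%:MP.
Proof. exact: comp_mpolyC. Qed.

Lemma eq_sym_map (phi psi : V -> W) : phi =1 psi -> sym_map phi =1 sym_map psi.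
Proof.
move=> e F; rewrite /sym_map; congr (_ \mPo _).
by apply: eq_from_tnth => i; rewrite !tnth_mktuple e.
Qed.

Lemma sym_inj_homog (w : W) : sym_inj w \is 1.-homog.
Proof.
rewrite /sym_inj; apply: rpred_sum => i _; apply: rpredZ.
by rewrite dhomogX /= mdeg1.
Qed.

Lemma sym_map_homog (phi : V -> W) d F :
  F \is d.-homog -> sym_map phi F \is d.-homog.
Proof.
move=> /dhomogP homF; rewrite /sym_map comp_mpolyE big_seq.
apply: rpred_sum => m /homF /= <-; apply: rpredZ; rewrite mdegE.
elim/big_rec2: _ => [|i k P _ homP]; first exact: dhomog1.
apply: dhomogM => //; rewrite tnth_mktuple.
by have := dhomogMn (m i) (sym_inj_homog (phi (tnth (vbasis {:V}) i))); rewrite mul1n.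
Qed.

End SymMap.

Lemma sym_map_comp (K : fieldType) (U V W : vectType K)
    (psi : {linear V -> W}) (phi : {linear U -> V}) F :
  sym_map psi (sym_map phi F) = sym_map (psi \o phi) F.
Proof.
move: F; apply: (symalg_rmorph_eq (f := sym_map psi \o sym_map phi)) => [c|v] /=.
  by rewrite !sym_mapC.
by rewrite !sym_map_inj.
Qed.

Lemma sym_map_id (K : fieldType) (V : vectType K) (phi : {linear V -> V}) F :
  phi =1 id -> sym_map phi F = F.
Proof.
move=> phi_id; move: F.
apply: (symalg_rmorph_eq (g := idfun)) => [c|v] /=; first exact: sym_mapC.
by rewrite sym_map_inj phi_id.
Qed.

Lemma coef_linear_mul (R : comNzRingType) (a b : R) (P : {poly R}) k :
  ((a%:P + b%:P * 'X) * P)`_k =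
  a * P`_k + (if k is j.+1 then b * P`_j else 0).
Proof.
rewrite mulrDl mulrAC coefD coefMX coefCM.
by case: k => [|k] //=; rewrite coefCM.
Qed.

Lemma size_linear_mul (R : comNzRingType) (a b : R) (P : {poly R}) k :
  (size P <= k)%N -> (size ((a%:P + b%:P * 'X) * P)%R <= k.+1)%N.
Proof.
move=> sP; apply/leq_sizeP => j lt_kj; rewrite coef_linear_mul.
rewrite nth_default; last by apply: leq_trans sP _; apply: ltnW.
case: j lt_kj => // j lt_kj.
by rewrite nth_default ?mulr0 ?add0r //; apply: leq_trans sP _.
Qed.

(** * The bigrading read off a pencil of linear maps *)

Section Pencil.
Variables (K : fieldType) (V W : vectType K) (p q : {linear V -> W}).

(* [pencil F] is F(p + X q), as a polynomial in X with coefficients in S(W). *)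
Definition pencil_gen (v : V) : {poly symalg W} :=
  (sym_inj (p v))%:P + (sym_inj (q v))%:P * 'X.

Definition poly_const : {rmorphism K -> {poly {mpoly K[\dim {:W}]}}} :=
  GRing.RMorphism.clone _ _ (@polyC {mpoly K[\dim {:W}]} \o @mpolyC _ K) _.

Definition pencil : symalg V -> {poly symalg W} := sym_ext poly_const pencil_gen.

HB.instance Definition _ := GRing.RMorphism.copy pencil (sym_ext _ pencil_gen).

Lemma pencilC c : pencil c%:MP = (c%:MP)%:P.
Proof. exact: sym_extC. Qed.

Lemma pencil_inj v :
  pencil (sym_inj v) = (sym_inj (p v))%:P + (sym_inj (q v))%:P * 'X.
Proof.
apply: sym_ext_inj => a u w; rewrite /pencil_gen !linearP /= -!mul_mpolyC.
by rewrite !polyCD !polyCM mulrDl mulrDr addrACA !mulrA.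
Qed.

Lemma pencilZ c F : pencil (c *: F) = (c%:MP)%:P * pencil F.
Proof. by rewrite -mul_mpolyC rmorphM /= pencilC. Qed.

Lemma pencil_coef0 F : (pencil F)`_0 = sym_map p F.
Proof.
rewrite -horner_coef0; move: F.
apply: (symalg_rmorph_eq (f := horner_eval 0 \o pencil)) => [c|v] /=.
  by rewrite /horner_eval pencilC hornerC sym_mapC.
by rewrite /horner_eval pencil_inj hornerD hornerMX mulr0 addr0 hornerC sym_map_inj.
Qed.

Lemma pencil_horner1 F : (pencil F).[1] = sym_map (p \+ q) F.
Proof.
move: F; apply: (symalg_rmorph_eq (f := horner_eval 1 \o pencil)) => [c|v] /=.
  by rewrite /horner_eval pencilC hornerC sym_mapC.
by rewrite /horner_eval pencil_inj hornerD hornerMX mulr1 !hornerC sym_map_inj linearD.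
Qed.

End Pencil.

Section Bigrading.
Variables (K : fieldType) (V : vectType K) (h r : {vspace V}).
Local Notation bg := (bigraded_part h r).

Lemma bigraded0 i j : bg i j 0.
Proof.
exists 0%N, (fun=> 0), (fun=> [tuple of nseq i 0]), (fun=> [tuple of nseq j 0]).
by rewrite big_ord0.
Qed.

Lemma bigradedD i j F G : bg i j F -> bg i j G -> bg i j (F + G).
Proof.
move=> [N1 [c1 [a1 [b1 ->]]]] [N2 [c2 [a2 [b2 ->]]]].
pose sel T (f1 : 'I_N1 -> T) (f2 : 'I_N2 -> T) (k : 'I_(N1 + N2)) :=
  match split k with inl k1 => f1 k1 | inr k2 => f2 k2 end.
exists (N1 + N2)%N, (sel _ c1 c2), (sel _ a1 a2), (sel _ b1 b2).
rewrite big_split_ord /=; congr (_ + _); apply: eq_bigr => k _; rewrite /sel.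
  by rewrite (unsplitK (inl _ k)).
by rewrite (unsplitK (inr _ k)).
Qed.

Lemma bigradedZ i j c F : bg i j F -> bg i j (c *: F).
Proof.
move=> [N [e [a [b ->]]]]; exists N, (fun k => c * e k), a, b.
by rewrite scaler_sumr; apply: eq_bigr => k _; rewrite scalerA.
Qed.

Lemma bigraded1 : bg 0 0 1.
Proof.
exists 1%N, (fun=> 1), (fun=> [tuple]), (fun=> [tuple]).
by rewrite big_ord1 !big_nil mulr1 scale1r.
Qed.

Lemma bigradedMl i j w F : w \in h -> bg i j F -> bg i.+1 j (sym_inj w * F).
Proof.
move=> wh [N [c [a [b ->]]]].
exists N, c, (fun k => [tuple of vsproj h w :: a k]), b.
rewrite mulr_sumr; apply: eq_bigr => k _.
by rewrite big_cons vsprojK // -scalerAr mulrA.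
Qed.

Lemma bigradedMr i j w F : w \in r -> bg i j F -> bg i j.+1 (sym_inj w * F).
Proof.
move=> wr [N [c [a [b ->]]]].
exists N, c, a, (fun k => [tuple of vsproj r w :: b k]).
rewrite mulr_sumr; apply: eq_bigr => k _.
by rewrite big_cons vsprojK // -scalerAr mulrCA.
Qed.

Variables (p q : {linear V -> V}).
Hypotheses (p_in : forall v, p v \in r) (q_in : forall v, q v \in h).

Let graded d (P : {poly symalg V}) :=
  (forall i j, (i + j)%N = d -> bg i j P`_i) /\ (size P <= d.+1)%N.

Let graded_monomial d m : mdeg m = d -> graded d (pencil p q 'X_[m]).
Proof.
elim: d m => [|d IHd] m dm.
  move/eqP: dm; rewrite mdeg_eq0 => /eqP ->; rewrite mpolyX0 rmorph1.
  split=> [i j /eqP|]; last by rewrite size_poly1.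
  rewrite addn_eq0 => /andP[/eqP-> /eqP->]; rewrite coef1; exact: bigraded1.
have [i mi] : exists i, m i != 0%N.
  apply/existsP; rewrite -negb_forall; apply: contra_eqN dm => /forallP m0.
  by rewrite mdegE big1 // => i _; apply/eqP.
have em : m = (U_(i) + (m - U_(i)))%MM.
  apply/mnmP=> j; rewrite mnmDE mnmBE mnm1E; case: eqVneq => [<-|_].
    by rewrite subnKC // lt0n.
  by rewrite subn0.
have [|IHbg IHsize] := IHd (m - U_(i))%MM.
  by move: dm; rewrite {1}em mdegD mdeg1 => -[].
rewrite em mpolyXD rmorphM -sym_inj_vbasis /= pencil_inj.
set P := pencil p q _ in IHbg IHsize *; set u := p _; set w := q _.
split=> [[|k] j kj|].
- rewrite coef_linear_mul addr0.
  move: kj; rewrite add0n => ->; apply: bigradedMr; first exact: p_in.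
  exact: IHbg.
- rewrite coef_linear_mul; apply: bigradedD; last first.
    by apply: bigradedMl; [exact: q_in | apply: IHbg; case: kj].
  case: j kj => [|j] kj; last first.
    by apply: bigradedMr; [exact: p_in | apply: IHbg; move: kj; rewrite addnS => -[]].
  (* No factor from [r] is left here, and the coefficient in question lies just beyond the size of
     [P]. *)
  rewrite nth_default ?mulr0; first exact: bigraded0.
  by move: kj; rewrite addn0 => -[->].
- exact: size_linear_mul.
Qed.

(** Since [q] lands in [h] and [p] in [r], the power of X counts the factors from [h]. This is the
    dictionary between coefficients and bihomogeneous components. *)
Lemma pencil_graded d F : F \is d.-homog ->
  (forall i j, (i + j)%N = d -> bg i j (pencil p q F)`_i) /\
  (size (pencil p q F) <= d.+1)%N.
Proof.
move=> /dhomogP homF; rewrite (mpolyE F) rmorph_sum /= big_seq.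
apply: (big_ind (graded d)) => [|P Q [bP sP] [bQ sQ]|m mF].
- by split=> [i j _|]; rewrite ?coef0 ?size_poly0 //; apply: bigraded0.
- split=> [i j e|]; first by rewrite coefD; apply: bigradedD; auto.
  by apply: leq_trans (size_polyD _ _) _; rewrite geq_max sP.
have [bX sX] := graded_monomial (homF m mF).
rewrite pencilZ mul_polyC; split=> [i j e|].
  by rewrite coefZ mul_mpolyC; apply: bigradedZ; apply: bX.
by apply: leq_trans (size_scale_leq _ _) sX.
Qed.

End Bigrading.

(** * Calculus of derivations along a morphism *)

Section PolyDerivation.
Variables (R : comNzRingType) (D : R -> R).
Hypothesis DD : forall F G, D (F + G) = D F + D G.
Hypothesis DM : forall F G, D (F * G) = D F * G + F * D G.

Let D0 : D 0 = 0.
Proof. by apply: (addrI (D 0)); rewrite -DD !addr0. Qed.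

Let D1 : D 1 = 0.
Proof. by apply: (addrI (D 1)); rewrite addr0 -[RHS](congr1 D (mulr1 1)) DM mulr1 mul1r. Qed.

Lemma coef_map_derivation P i : (map_poly D P)`_i = D P`_i.
Proof. exact: coef_map_id0. Qed.

Lemma map_derivationD P Q : map_poly D (P + Q) = map_poly D P + map_poly D Q.
Proof. by apply/polyP => i; rewrite !(coefD, coef_map_derivation) DD. Qed.

Lemma map_derivationM P Q :
  map_poly D (P * Q) = map_poly D P * Q + P * map_poly D Q.
Proof.
apply/polyP => i; rewrite coefD coef_map_derivation !coefM -big_split.
rewrite (big_morph D DD D0); apply: eq_bigr => j _ /=.
by rewrite DM !coef_map_derivation.
Qed.

Lemma map_derivationC F : map_poly D F%:P = (D F)%:P.
Proof.
by apply/polyP => i; rewrite coef_map_derivation !coefC; case: ifP => _.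
Qed.

Lemma map_derivationX : map_poly D 'X = 0.
Proof.
by apply/polyP => i; rewrite coef_map_derivation coefX coef0; case: eqP.
Qed.

Lemma map_derivation_linear a b :
  map_poly D (a%:P + b%:P * 'X) = (D a)%:P + (D b)%:P * 'X.
Proof.
rewrite map_derivationD map_derivationM map_derivationX mulr0 addr0.
by rewrite !map_derivationC.
Qed.

End PolyDerivation.

Lemma map_derivation_along (K : fieldType) (V W : vectType K)
    (D : symalg V -> symalg V) (f : {rmorphism symalg W -> {poly symalg V}}) :
  derivation_along idfun D -> (forall c, f c%:MP = (c%:MP)%:P) ->
  derivation_along f (map_poly D \o f).
Proof.
move=> [DD DM DC] fC; split=> [F G|F G|c] /=.
- by rewrite rmorphD map_derivationD.
- by rewrite rmorphM map_derivationM.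
- by rewrite fC map_derivationC // DC.
Qed.

Section DerivationOps.
Variables (K : fieldType) (n : nat) (C : comNzRingType).
Local Notation A := {mpoly K[n]}.
Variable phi : A -> C.

Lemma derivation_add (D1 D2 : A -> C) :
  derivation_along phi D1 -> derivation_along phi D2 ->
  derivation_along phi (fun F => D1 F + D2 F).
Proof.
move=> [D1D D1M D1C] [D2D D2M D2C]; split=> [F G|F G|c].
- by rewrite D1D D2D addrACA.
- by rewrite D1M D2M mulrDl mulrDr addrACA.
- by rewrite D1C D2C addr0.
Qed.

Lemma derivation_mulr (D : A -> C) c :
  derivation_along phi D -> derivation_along phi (fun F => D F * c).
Proof.
move=> [DD DM DC]; split=> [F G|F G|e].
- by rewrite DD mulrDl.
- by rewrite DM mulrDl mulrAC mulrA.
- by rewrite DC mul0r.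
Qed.

Lemma derivation_zero : derivation_along phi (fun=> 0 : C).
Proof. by split=> *; rewrite ?mul0r ?mulr0 ?addr0. Qed.

End DerivationOps.

Lemma derivation_comp_rmorph (K : fieldType) n (C : comNzRingType)
    (f : {rmorphism {mpoly K[n]} -> C}) (D : {mpoly K[n]} -> {mpoly K[n]}) :
  derivation_along idfun D -> derivation_along f (f \o D).
Proof.
move=> [DD DM DC]; split=> [F G|F G|e] /=.
- by rewrite DD rmorphD.
- by rewrite DM rmorphD !rmorphM.
- by rewrite DC rmorph0.
Qed.

Lemma derivation_deriv (K : fieldType) n (R : comNzRingType)
    (phi : {rmorphism {mpoly K[n]} -> {poly R}}) (iota : K -> R) :
  (forall c, phi c%:MP = (iota c)%:P) ->
  derivation_along phi (fun F => (phi F)^`()).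
Proof.
move=> phiC; split=> [F G|F G|e].
- by rewrite rmorphD derivD.
- by rewrite rmorphM derivM.
- by rewrite phiC derivC.
Qed.

Lemma derivation_rmorph_comp (K : fieldType) n m (C : comNzRingType)
    (f : {rmorphism {mpoly K[n]} -> {mpoly K[m]}}) (phi D : {mpoly K[m]} -> C) :
  (forall c, f c%:MP = c%:MP) -> derivation_along phi D ->
  derivation_along (phi \o f) (D \o f).
Proof.
move=> fC [DD DM DC]; split=> [F G|F G|e] /=.
- by rewrite rmorphD DD.
- by rewrite rmorphM DM.
- by rewrite fC DC.
Qed.

(** The coefficient of X^(n+1) in the identity [pencil_ad] below. The term in X^2 is reached at
    index n - 1, so it is absent for n = 0, whence the guard on [S]. *)
Lemma pencil_coef_mul (R : comNzRingType) (P Q S T : {poly R}) n :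
  P + Q * 'X + S * 'X^2 = T * 'X -> T`_n = 0 -> Q`_n = 0 ->
  ((0 < n)%N -> S`_n.-1 = 0) -> P`_n.+1 = 0.
Proof.
move=> e T0 Q0 S0; have := congr1 (fun U : {poly R} => U`_n.+1) e.
rewrite !coefD !coefMX coefMXn /= T0 Q0 addr0.
by case: n S0 {e T0 Q0} => [|n] S0; rewrite ?addr0 //= subSS subn1 S0 // addr0.
Qed.

Lemma pencil_identity (R : comNzRingType) (a b c : R) :
  (0%:P + a%:P * 'X) + (0%:P + b%:P * 'X) * 'X + (c%:P + 0%:P * 'X) * 'X^2 =
  (a%:P + (b + c)%:P * 'X) * 'X.
Proof. by rewrite polyCD polyC0 !(add0r, mul0r, addr0) !mulrDl expr2 !mulrA addrA. Qed.

(** * Invariants restricted to a pencil of linear maps *)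

Lemma sym_ad_derivation (K : fieldType) (g : lieAlgType K) (x : g) :
  derivation_along idfun (sym_ad x).
Proof.
exact: (derivation_sum_mderiv idfun (fun i => sym_inj (lie x (tnth (vbasis {:g}) i)))).
Qed.

Section Transversality.
Variables (K : fieldType) (g : lieAlgType K).
Hypothesis K0 : [pchar K] =i pred0.
Local Notation A := (symalg g).
Variables p q : {linear g -> g}.
Hypotheses (pp : forall v, p (p v) = p v) (qq : forall v, q (q v) = q v).
Hypotheses (pq : forall v, p (q v) = 0) (qp : forall v, q (p v) = 0).
Local Notation pencil := (pencil p q).

Definition linder (f : {linear g -> g}) : A -> A := sym_der idfun (@sym_inj K g \o f).

Lemma linder_derivation (f : {linear g -> g}) : derivation_along idfun (linder f).
Proof. exact: sym_der_derivation. Qed.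

Lemma linder_inj (f : {linear g -> g}) v : linder f (sym_inj v) = sym_inj (f v).
Proof. by apply: sym_der_inj => a u w; rewrite /= !linearP mul_mpolyC. Qed.

(** Euler's identity: [linder q] and X d/dX both count the factors taken through [q], and both are
    derivations along [pencil]. *)
Lemma pencil_euler n F : linder q (pencil F)`_n = (pencil F)`_n *+ n.
Proof.
have dq := linder_derivation q; have [DD DM _] := dq.
have e : map_poly (linder q) \o pencil =1 (fun G => (pencil G)^`() * 'X).
  apply: (symalg_derivation_eq (phi := pencil)).
  - exact: (map_derivation_along dq (pencilC p q)).
  - by apply: derivation_mulr; apply: derivation_deriv => c; apply: pencilC.
  move=> v /=; rewrite !pencil_inj map_derivationD // map_derivationM //.
  rewrite !map_derivationC // map_derivationX // mulr0 addr0 !linder_inj qp qq.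
  rewrite linear0 polyC0 add0r derivD derivC add0r derivM derivC mul0r add0r derivX.
  by rewrite mulr1.
have := congr1 (fun P : {poly A} => P`_n) (e F) => /=.
rewrite coef_map_derivation // coefMX => ->.
by case: n => [|n] //=; rewrite coef_deriv.
Qed.

Section Leading.
Variable x : g.
Hypothesis Hp : forall v, p (lie x v) = p (lie x (q v)).
Hypothesis Hq : forall v, q (lie x v) = q (lie x (q v)) + q (lie x (p v)).

Let D0 : {linear g -> g} := p \o (lie x \o q).
Let D1 : {linear g -> g} := q \o (lie x \o q).
Let D2 : {linear g -> g} := q \o (lie x \o p).

(** [D0] lowers the degree in the image of [q] by one, [D1] keeps it and [D2] raises it. The extra
    factor X on both sides keeps all exponents non-negative. *)
Let pencil_ad F :
  map_poly (linder D0) (pencil F) + map_poly (linder D1) (pencil F) * 'X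
    + map_poly (linder D2) (pencil F) * 'X^2 = pencil (sym_ad x F) * 'X.
Proof.
have d0 := linder_derivation D0; have [D0D D0M _] := d0.
have d1 := linder_derivation D1; have [D1D D1M _] := d1.
have d2 := linder_derivation D2; have [D2D D2M _] := d2.
move: F; apply: (symalg_derivation_eq (phi := pencil)).
- apply: derivation_add; last first.
    exact: derivation_mulr (map_derivation_along d2 (pencilC p q)).
  apply: derivation_add; first exact: map_derivation_along d0 (pencilC p q).
  exact: derivation_mulr (map_derivation_along d1 (pencilC p q)).
- by apply: derivation_mulr; apply: derivation_comp_rmorph; apply: sym_ad_derivation.
move=> v /=.
rewrite sym_ad_inj.
rewrite !pencil_inj.
rewrite (map_derivation_linear D0D D0M) (map_derivation_linear D1D D1M).
rewrite (map_derivation_linear D2D D2M).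
rewrite !linder_inj /= (Hp v) (Hq v) !qp !pp !qq !pq !linear0 linearD.
exact: pencil_identity.
Qed.

(** In the coefficient of X^(n+1) all terms but the one of [D0] vanish. The index 0, where F is not
    assumed to vanish, can enter twice: [D1] kills that coefficient because q p = 0, and for n = 1
    its image under [D2] is removed by the last hypothesis. *)
Lemma pencil_leading F n :
  sym_invariant F -> (forall i, (0 < i <= n)%N -> (pencil F)`_i = 0) ->
  (pencil F)`_0 = 0 \/ (forall v, q (lie x (p v)) = 0) ->
  linder D0 (pencil F)`_n.+1 = 0.
Proof.
move=> invF F0 H0.
have d1 := linder_derivation D1; have [D1D D1M D1C] := d1.
have d2 := linder_derivation D2; have [D2D D2M D2C] := d2.
have [D0D D0M D0C] := linder_derivation D0.
have D1z : linder D1 0 = 0 by rewrite -mpolyC0 D1C.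
have D2z : linder D2 0 = 0 by rewrite -mpolyC0 D2C.
rewrite -(coef_map_derivation D0D).
have adF := pencil_ad F; rewrite invF rmorph0 in adF.
apply: (pencil_coef_mul adF); first exact: coef0.
- rewrite (coef_map_derivation D1D).
  case: n F0 => [|n] F0; last by rewrite F0 // leqnn.
  rewrite pencil_coef0; move: F {invF F0 H0 adF}.
  apply: (symalg_derivation_eq (D1 := linder D1 \o sym_map p)
    (derivation_rmorph_comp (sym_mapC p) d1) (derivation_zero _)) => v /=.
  by rewrite sym_map_inj linder_inj /= qp !linear0.
- case: n F0 => [|n] F0 //= _; rewrite (coef_map_derivation D2D).
  case: n F0 => [|n] F0; last by rewrite F0 ?D2z //= leqW.
  case: H0 => [->|q0]; first exact: D2z.
  by rewrite /linder /sym_der big1 // => i _; rewrite /= q0 linear0 mul0r.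
Qed.

End Leading.

(* Infinitesimal form of the statement that the orbits meet the fixed space of
   [p] transversally: [x k], [e k] are dual families for the form
   [p (lie (x k) (q v)) = phi k v *: h k]. *)
Lemma invariant_pencil_coef (J : finType) (Q : pred J) (x e h : J -> g)
    (phi : J -> g -> K) (F : A) :
  (forall k v, Q k -> p (lie (x k) v) = p (lie (x k) (q v))) ->
  (forall k v, Q k -> q (lie (x k) v) = q (lie (x k) (q v)) + q (lie (x k) (p v))) ->
  (forall k, Q k -> h k != 0) ->
  (forall k v, Q k -> p (lie (x k) (q v)) = phi k v *: h k) ->
  (forall v, q v = \sum_(k | Q k) phi k v *: e k) ->
  sym_invariant F ->
  (pencil F)`_0 = 0 \/ (forall k v, Q k -> q (lie (x k) (p v)) = 0) ->
  forall n, (pencil F)`_n.+1 = 0.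
Proof.
move=> Hp Hq nz_h pxq qE invF F0 n.
elim/ltn_ind: n => n IHn.
have lead k : Q k -> linder (p \o (lie (x k) \o q)) (pencil F)`_n.+1 = 0.
  move=> Qk; apply: pencil_leading => //; [by move=> v; apply: Hp|by move=> v; apply: Hq| |].
    by case=> [|i] // /andP[_ le_i]; apply: IHn.
  by case: F0 => [?|q0]; [left | right => v; apply: q0].
set G := (pencil F)`_n.+1 in lead *.
(* The derivation of [lead k] is [sym_inj (h k)] times the derivation with constant values [phi k];
   as S(g) is a domain, the latter kills [G]. *)
pose E k := \sum_i (phi k (tnth (vbasis {:g}) i))%:MP * G^`M(i) : A.
have E0 k : Q k -> E k = 0.
  move=> Qk; have := lead k Qk; rewrite /linder /sym_der /=.
  under eq_bigr => i _ do rewrite pxq // linearZ /= -mul_mpolyC mulrAC mulrC.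
  rewrite -big_distrr /= => /eqP; rewrite mulf_eq0 sym_inj_eq0 (negPf (nz_h k Qk)).
  by move/eqP.
have : linder q G = 0.
  rewrite /linder /sym_der /=.
  transitivity (\sum_(k | Q k) sym_inj (e k) * E k).
    under [RHS]eq_bigr => k _ do rewrite big_distrr /=.
    rewrite exchange_big; apply: eq_bigr => i _ /=.
    rewrite qE linear_sum mulr_suml; apply: eq_bigr => k _.
    by rewrite linearZ /= -mul_mpolyC mulrCA mulrA.
  by rewrite big1 // => k Qk; rewrite E0 ?mulr0.
rewrite pencil_euler -mulr_natr => /eqP; rewrite mulf_eq0 natr_mpoly_eq0 // orbF.
by move/eqP.
Qed.

End Transversality.

(** * Lie algebras and the root decomposition *)

Lemma extract_basis (K : fieldType) (V : vectType K) (s : seq V) :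
  exists b : seq V, [/\ free b, <<b>>%VS = <<s>>%VS & {subset b <= s}].
Proof.
elim: s => [|v s [b [free_b span_b sub_b]]]; first by exists [::]; rewrite nil_free.
have [v_in|v_notin] := boolP (v \in <<s>>%VS).
  exists b; split=> //; last by move=> u /sub_b us; rewrite inE us orbT.
  by rewrite span_cons span_b; apply/esym/addv_idPr; rewrite -memvE.
exists (v :: b); rewrite free_cons free_b span_b v_notin !span_cons span_b; split=> // u.
by rewrite !inE => /predU1P[->|/sub_b->]; rewrite ?eqxx ?orbT.
Qed.

Section LieBasics.
Variables (K : fieldType) (g : lieAlgType K).
Implicit Types x y z : g.

Lemma lieDr x y z : lie x (y + z) = lie x y + lie x z.
Proof. exact: linearD. Qed.
Lemma lieDl x y z : lie (x + y) z = lie x z + lie y z.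
Proof. exact: (linearD (lie_r z)). Qed.
Lemma lieZr a x y : lie x (a *: y) = a *: lie x y.
Proof. exact: linearZ_LR. Qed.
Lemma lieZl a x y : lie (a *: x) y = a *: lie x y.
Proof. exact: (linearZ_LR (lie_r y)). Qed.
Lemma lie0r x : lie x 0 = 0.
Proof. exact: linear0. Qed.
Lemma lie0l y : lie 0 y = 0.
Proof. exact: (linear0 (lie_r y)). Qed.
Lemma lie_sumr I (s : seq I) (P : pred I) (E : I -> g) x :
  lie x (\sum_(i <- s | P i) E i) = \sum_(i <- s | P i) lie x (E i).
Proof. exact: linear_sum. Qed.
Lemma lie_suml I (s : seq I) (P : pred I) (E : I -> g) y :
  lie (\sum_(i <- s | P i) E i) y = \sum_(i <- s | P i) lie (E i) y.
Proof. exact: (linear_sum (lie_r y)). Qed.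

Lemma lieC x y : lie x y = - lie y x.
Proof.
have := liexx (x + y); rewrite lieDl !lieDr !liexx add0r addr0.
by move/eqP; rewrite addr_eq0 => /eqP.
Qed.

Lemma lie_lieA x y z : lie x (lie y z) = lie (lie x y) z + lie y (lie x z).
Proof.
have /eqP := lie_jacobi x y z; rewrite -addrA addr_eq0 => /eqP ->.
by rewrite opprD addrC [lie (lie x y) z]lieC [lie x z]lieC linearN.
Qed.

Lemma mem_lie_prodv (U V : {vspace g}) x y :
  x \in U -> y \in V -> lie x y \in lie_prodv U V.
Proof.
move=> xU yV; rewrite (coord_vbasis xU) (coord_vbasis yV) lie_suml.
apply: memv_suml => i _; rewrite lie_sumr; apply: memv_suml => j _.
rewrite lieZl lieZr !memvZ // memv_span //.
by apply: allpairs_f; rewrite mem_nth // size_tuple.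
Qed.

Lemma lie_prodv_subP (U V W : {vspace g}) :
  (forall x y, x \in U -> y \in V -> lie x y \in W) -> (lie_prodv U V <= W)%VS.
Proof.
move=> UVW; apply/span_subvP => _ /allpairsP[[x y] [/= xU yV ->]].
by apply: UVW; apply: vbasis_mem.
Qed.

Hypothesis g_reductive : reductive g.

Lemma ideal_lieC (I : {vspace g}) x y : lie_ideal I -> x \in I -> lie x y \in I.
Proof. by move=> idI xI; rewrite lieC memvN; apply: idI. Qed.

Lemma ideals_lie0 (I J : {vspace g}) x y : lie_ideal I -> lie_ideal J ->
  (I :&: J = 0)%VS -> x \in I -> y \in J -> lie x y = 0.
Proof.
move=> idI idJ IJ0 xI yJ; apply/eqP; rewrite -memv0 -IJ0 memv_cap.
by rewrite ideal_lieC // idJ.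
Qed.

(** The line of a central element is an ideal with a complementary ideal J. The components of x and
    y in the line are central, so the commutator is computed inside J and meets the line only in
    0. *)
Lemma central_commutator_eq0 x y :
  (forall z, lie z (lie x y) = 0) -> lie x y = 0.
Proof.
set c := lie x y => c_central.
have idI : lie_ideal <[c]>%VS.
  by move=> z _ /vlineP[a ->]; rewrite lieZr c_central scaler0 mem0v.
have [J [idJ IJ IJ0]] := g_reductive idI.
have split_g z : exists2 i, i \in <[c]>%VS & exists2 j, j \in J & z = i + j.
  by have := memvf z; rewrite -IJ => /memv_addP[i iI [j jJ ->]]; exists i => //; exists j.
have cI i z : i \in <[c]>%VS -> lie i z = 0.
  by case/vlineP=> a ->; rewrite lieZl lieC c_central oppr0 scaler0.
have [i iI [j jJ ex]] := split_g x; have [i' iI' [j' jJ' ey]] := split_g y.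
apply/eqP; rewrite -memv0 -IJ0 memv_cap memv_line /= /c ex ey lieDl !lieDr.
by rewrite !(cI i _ iI) [lie j i']lieC (cI i' _ iI') oppr0 !add0r idJ.
Qed.

Section TorusAbelian.
Variables (t : lieSubalg g) (up um : {vspace g}).
Hypothesis t_nilpotent : lie_nilpotent t.
Hypothesis tri : triangular_decomposition t up um.

Let D := lie_prodv t t.

Let D_sub_t : (D <= t)%VS.
Proof. by apply: lie_prodv_subP => x y; apply: lieSubalgP. Qed.

Let vsval_t x : x \in lieSubalg_vs t -> vsval (vsproj t x : lie_sub t) = x.
Proof. exact: vsprojK. Qed.

Let D_root alpha e : e \in rootspace (t := t) alpha -> forall y, y \in D -> lie y e = 0.
Proof.
move=> /rootspaceP eE.
have sub : (D <= lker (linfun (lie_r e)))%VS.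
  apply: lie_prodv_subP => x y xt yt; rewrite memv_ker lfunE /= /lie_r.
  have ex := eE (vsproj t x); have ey := eE (vsproj t y).
  rewrite !vsval_t // in ex ey.
  have := lie_lieA x y e; rewrite ey lieZr ex lieZr ey !scalerA mulrC => /eqP.
  by rewrite -subr_eq subrr eq_sym.
by move=> y /(subvP sub); rewrite memv_ker lfunE => /eqP.
Qed.

Let D_roots (s : seq 'Hom(lie_sub t, K^o)) f e y :
  e \in (\sum_(alpha <- s) rootspace (f alpha : 'Hom(lie_sub t, K^o)))%VS -> y \in D -> lie y e = 0.
Proof.
move=> es yD; have sub : (\sum_(alpha <- s) rootspace (f alpha) <= lker (linfun (lie y)))%VS.
  elim: s {es} => [|alpha s IHs]; first by rewrite big_nil sub0v.
  rewrite big_cons subv_add IHs andbT; apply/subvP => v valpha.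
  by rewrite memv_ker lfunE /= (D_root valpha).
by have := subvP sub e es; rewrite memv_ker lfunE => /eqP.
Qed.

Let D_ideal : lie_ideal D.
Proof.
have [Dp [_ upE umE full_g _]] := tri.
move=> x y yD; have := memvf x; rewrite -full_g.
case/memv_addP=> _ /memv_addP[a a_up [b b_t ->]] [c c_um ->].
rewrite !lieDl [lie a y]lieC [lie c y]lieC.
rewrite upE in a_up; rewrite umE in c_um.
rewrite (D_roots (f := id) a_up yD) (D_roots (f := -%R) c_um yD) oppr0 add0r addr0.
by apply: mem_lie_prodv => //; apply: (subvP D_sub_t).
Qed.

(** [t, t] kills every root vector, because t acts on it by scalars; so [t, t] is an ideal of g. A
    complementary ideal shows it to be perfect, and a perfect subalgebra of the nilpotent t is
    zero. *)
Lemma torus_abelian x y : x \in lieSubalg_vs t -> y \in lieSubalg_vs t -> lie x y = 0.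
Proof.
have [J [idJ DJ DJ0]] := g_reductive D_ideal.
have DD : (D <= lie_prodv D D)%VS.
  apply: lie_prodv_subP => h h' ht h't.
  have hD : lie h h' \in D by apply: mem_lie_prodv.
  have := memvf h; rewrite -DJ => /memv_addP[d dD [j jJ eh]].
  have := memvf h'; rewrite -DJ => /memv_addP[d' dD' [j' jJ' eh']].
  have ehh : lie h h' = lie d d' + lie j j'.
    rewrite eh eh' lieDl !lieDr (ideals_lie0 D_ideal idJ DJ0 dD jJ').
    by rewrite [lie j d']lieC (ideals_lie0 D_ideal idJ DJ0 dD' jJ) oppr0 add0r addr0.
  have j0 : lie j j' = 0.
    apply/eqP; rewrite -memv0 -DJ0 memv_cap idJ // andbT.
    have -> : lie j j' = lie h h' - lie d d' by rewrite ehh addrC addKr.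
    by rewrite memvB // D_ideal.
  by rewrite ehh j0 addr0 mem_lie_prodv.
have [k tk0] := t_nilpotent.
have sub_iter i : (D <= iter i (lie_prodv t) t)%VS.
  elim: i => [|i IHi] //=; apply: subv_trans DD _.
  by apply: lie_prodv_subP => a b aD bD; apply: mem_lie_prodv;
    [apply: (subvP D_sub_t) | apply: (subvP IHi)].
have := sub_iter k; rewrite tk0 subv0 => /eqP D0.
move=> xt yt; apply/eqP; rewrite -memv0 -D0; exact: mem_lie_prodv.
Qed.

End TorusAbelian.

End LieBasics.

(** * The Killing form in a basis of weight vectors *)

Lemma trace_bracket (K : fieldType) n (X Y Z : 'M[K]_n) :
  \tr ((X *m Y - Y *m X) *m Z) = \tr (X *m (Y *m Z - Z *m Y)).
Proof.
rewrite mulmxBl mulmxBr !raddfB /= mulmxA; congr (_ - _).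
by rewrite -mulmxA mxtrace_mulC mulmxA.
Qed.

Section WeightBasis.
Import Order.TTheory Num.Theory.
Variables (K : fieldType) (g : lieAlgType K) (t : lieSubalg g).
Hypothesis K0 : [pchar K] =i pred0.
Hypothesis g_reductive : reductive g.
Hypothesis t_abelian :
  forall x y, x \in lieSubalg_vs t -> y \in lieSubalg_vs t -> lie x y = 0.
Local Notation weight := 'Hom(lie_sub t, K^o).
Variables (n : nat) (b : n.-tuple g) (w : 'I_n -> weight).
Hypothesis b_basis : basis_of {:g} b.
Hypothesis b_weight : forall i : 'I_n, b`_i \in rootspace (w i).
Hypothesis b_zero : forall i : 'I_n, w i = 0 -> b`_i \in lieSubalg_vs t.

Local Notation co := (coord b).

Let free_b : free b. Proof. exact: basis_free b_basis. Qed.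

Let coE x : x = \sum_i co i x *: b`_i.
Proof. by apply: coord_basis b_basis _; apply: memvf. Qed.

Let co_b (i j : 'I_n) : co i b`_j = (i == j)%:R.
Proof. by rewrite coord_free // eq_sym. Qed.

Let co_inj x : (forall i, co i x = 0) -> x = 0.
Proof. by move=> x0; rewrite (coE x) big1 // => i _; rewrite x0 scale0r. Qed.

Let natK_eq0 k : (k%:R == 0 :> K) = (k == 0)%N.
Proof. by move: k; apply/pcharf0P. Qed.

Lemma lie_weight (i : 'I_n) (h : lie_sub t) : lie (vsval h) b`_i = (w i h : K) *: b`_i.
Proof. exact/rootspaceP. Qed.

Lemma coord_lie_torus i (h : lie_sub t) x : co i (lie (vsval h) x) = (w i h : K) * co i x.
Proof.
rewrite {1}(coE x) lie_sumr linear_sum (bigD1 i) //= big1 => [|j ne_ji].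
  by rewrite lieZr lie_weight !linearZ /= co_b eqxx mulr1 addr0 mulrC.
by rewrite lieZr lie_weight !linearZ /= co_b eq_sym (negPf ne_ji) !mulr0.
Qed.

Lemma coord_rootspace i (alpha : weight) x :
  x \in rootspace alpha -> co i x != 0 -> w i = alpha.
Proof.
move=> /rootspaceP xE nz; apply/lfunP => h.
have := coord_lie_torus i h x; rewrite xE linearZ /= => /eqP.
by rewrite -subr_eq0 -mulrBl mulf_eq0 (negPf nz) orbF subr_eq0 => /eqP.
Qed.

Lemma coord_rootspace0 i (alpha : weight) x :
  x \in rootspace alpha -> w i != alpha -> co i x = 0.
Proof. by move=> xa; apply: contraNeq => /(coord_rootspace xa) ->. Qed.

Lemma rootspace0_torus x : (x \in rootspace (0 : weight)) = (x \in lieSubalg_vs t).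
Proof.
apply/idP/idP => [x0|xt].
  rewrite (coE x); apply: memv_suml => i _.
  have [w0|nz] := eqVneq (w i) 0; first by rewrite memvZ // b_zero.
  by rewrite (coord_rootspace0 x0) // scale0r mem0v.
by apply/rootspaceP => h; rewrite zero_lfunE scale0r t_abelian // subvsP.
Qed.

Lemma lie_rootspace (alpha beta : weight) x y :
  x \in rootspace alpha -> y \in rootspace beta -> lie x y \in rootspace (alpha + beta).
Proof.
move=> /rootspaceP xE /rootspaceP yE; apply/rootspaceP => h.
by rewrite lie_lieA xE yE lieZl lieZr -scalerDl add_lfunE.
Qed.

(** A single notion of projection serves for the torus, for a single weight space, for either
    nilradical and for all root vectors together. *)
Definition wcomp (P : pred weight) (x : g) : g := \sum_(i | P (w i)) co i x *: b`_i.

Fact wcomp_linear P : linear (wcomp P).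
Proof.
move=> a x y; rewrite /wcomp scaler_sumr -big_split; apply: eq_bigr => i _ /=.
by rewrite linearP scalerDl scalerA.
Qed.
HB.instance Definition _ P := GRing.isLinear.Build K g g _ (wcomp P) (wcomp_linear P).

Lemma coord_wcomp P i x : co i (wcomp P x) = if P (w i) then co i x else 0.
Proof.
rewrite /wcomp linear_sum; case: ifP => Pi.
  rewrite (bigD1 i) //= big1 => [|j /andP[_ ne_ji]].
    by rewrite linearZ /= co_b eqxx mulr1 addr0.
  by rewrite linearZ /= co_b eq_sym (negPf ne_ji) mulr0.
rewrite big1 // => j Pj; rewrite linearZ /= co_b.
by case: eqP => [e|_]; rewrite ?mulr0 //; rewrite -e Pi in Pj.
Qed.

Lemma eq_coord x y : (forall i, co i x = co i y) -> x = y.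
Proof.
move=> exy; apply/eqP; rewrite -subr_eq0; apply/eqP/co_inj => i.
by rewrite linearB /= exy subrr.
Qed.

Lemma wcomp1_rootspace (alpha : weight) x : wcomp (pred1 alpha) x \in rootspace alpha.
Proof. by apply: memv_suml => i /eqP <-; apply: memvZ. Qed.

Lemma wcomp_rootspace P (alpha : weight) x :
  x \in rootspace alpha -> wcomp P x = if P alpha then x else 0.
Proof.
move=> xa; apply: eq_coord => i; rewrite coord_wcomp.
have [<-|ne] := eqVneq (w i) alpha; first by case: ifP; rewrite ?linear0.
by rewrite (coord_rootspace0 xa ne) !if_same; case: ifP; rewrite ?linear0 ?(coord_rootspace0 xa ne).
Qed.

Definition adM (x : g) : 'M[K]_n := \matrix_(i, j) co i (lie x b`_j).

Lemma adM_lie x y : adM (lie x y) = adM x *m adM y - adM y *m adM x.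
Proof.
have mulE u v i j : (adM u *m adM v) i j = co i (lie u (lie v b`_j)).
  rewrite {1}(coE (lie v b`_j)) lie_sumr linear_sum mxE; apply: eq_bigr => k _.
  by rewrite !mxE lieZr linearZ /= mulrC.
apply/matrixP => i j; rewrite [LHS]mxE [RHS]mxE [X in _ + X]mxE !mulE.
by rewrite lie_lieA linearD /= addrK.
Qed.

Definition killing (x y : g) : K := \tr (adM x *m adM y).

Lemma adM_linear : linear adM.
Proof. by move=> a x y; apply/matrixP => i j; rewrite !mxE lieDl lieZl linearP. Qed.
HB.instance Definition _ := GRing.isLinear.Build K g 'M[K]_n _ adM adM_linear.

Lemma killing_sumr I (s : seq I) (P : pred I) (E : I -> g) x :
  killing x (\sum_(i <- s | P i) E i) = \sum_(i <- s | P i) killing x (E i).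
Proof. by rewrite /killing linear_sum mulmx_sumr linear_sum. Qed.

Lemma killing_suml I (s : seq I) (P : pred I) (E : I -> g) y :
  killing (\sum_(i <- s | P i) E i) y = \sum_(i <- s | P i) killing (E i) y.
Proof. by rewrite /killing linear_sum mulmx_suml linear_sum. Qed.

Lemma killingZr a x y : killing x (a *: y) = a * killing x y.
Proof. by rewrite /killing linearZ /= -scalemxAr linearZ. Qed.

Lemma killingZl a x y : killing (a *: x) y = a * killing x y.
Proof. by rewrite /killing linearZ /= -scalemxAl linearZ. Qed.

Lemma killing_lie x y z : killing (lie x y) z = killing x (lie y z).
Proof.
by rewrite /killing !adM_lie trace_bracket.
Qed.

Lemma adM_shift (alpha : weight) x i j :
  x \in rootspace alpha -> adM x i j != 0 -> w i = alpha + w j.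
Proof. by move=> xa; rewrite mxE; apply: coord_rootspace; apply: lie_rootspace. Qed.

(** The product of the two adjoint matrices shifts weights by [alpha + beta]; a non-zero shift
    leaves no diagonal entry. *)
Lemma killing_orth (alpha beta : weight) x y :
  x \in rootspace alpha -> y \in rootspace beta -> killing x y != 0 -> alpha + beta = 0.
Proof.
move=> xa yb; apply: contraNeq => ne0; rewrite /killing /mxtrace big1 // => i _.
rewrite mxE big1 // => j _; apply/eqP; rewrite mulf_eq0.
have [//|/(adM_shift xa) wi] := eqVneq (adM x i j) 0.
have [//|/(adM_shift yb) wj] := eqVneq (adM y j i) 0.
by case/eqP: ne0; move: wi; rewrite wj addrA -[LHS]add0r => /addIr <-.
Qed.

Lemma adM_torus (h : lie_sub t) i j : adM (vsval h) i j = (w i h : K) *+ (i == j).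
Proof. by rewrite mxE coord_lie_torus co_b mulr_natr. Qed.

Lemma killing_torus (h : lie_sub t) : killing (vsval h) (vsval h) = \sum_i (w i h : K) ^+ 2.
Proof.
apply: eq_bigr => i _; rewrite mxE (bigD1 i) //= big1 => [|j ne_ji].
  by rewrite !adM_torus eqxx addr0.
by rewrite !adM_torus eq_sym (negPf ne_ji) mul0r.
Qed.

(* The ad-string through a weight is stable under [ad x] and [ad y], so the
   trace of [ad (lie x y)] on it vanishes. *)
Lemma coroot_rational (alpha : weight) x y (h : lie_sub t) i :
  x \in rootspace alpha -> y \in rootspace (- alpha) -> vsval h = lie x y ->
  exists m : nat, exists z : int, (0 < m)%N /\ (w i h : K) *+ m = (alpha h : K) *~ z.
Proof.
move=> xa ya hE.
pose e j k := (w k == alpha + w j) || (w j == alpha + w k).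
(* [diag_mx c] projects onto the span of the basis vectors whose weight is linked to [w i] by steps
   of [alpha] through the weights of the basis. *)
pose c := \row_k ((connect e i k)%:R : K).
have conn j k : w k = alpha + w j -> connect e i j = connect e i k.
  move=> wk; apply/idP/idP => /connect_trans; apply; apply: connect1;
  by rewrite /e wk eqxx ?orbT.
have comm : adM y *m diag_mx c = diag_mx c *m adM y.
  apply/matrixP => j k; rewrite mul_mx_diag mul_diag_mx !mxE mulrC.
  have [->|nz] := eqVneq (co j (lie y b`_k)) 0; first by rewrite !mulr0.
  rewrite (conn j k) //; have -> := @adM_shift _ y j k ya; first by rewrite addrA subrr add0r.
  by rewrite mxE.
have tr0 : \tr (adM (vsval h) *m diag_mx c) = 0.
  rewrite hE adM_lie mulmxBl raddfB /= -[adM x *m _ *m _]mulmxA comm mulmxA.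
  by rewrite -[adM y *m _ *m _]mulmxA [X in _ - X]mxtrace_mulC subrr.
have shift k : connect e i k -> exists z : int, (w k h : K) = (w i h : K) + (alpha h : K) *~ z.
  case/connectP=> p; elim/last_ind: p k => [|p j IHp] k.
    by move=> _ ->; exists 0; rewrite mulr0z addr0.
  rewrite rcons_path last_rcons => /andP[ep elast ->{k}].
  have [z wz] := IHp _ ep erefl; case/orP: elast => /eqP/(congr1 (fun f : weight => f h)).
    rewrite add_lfunE => ->; exists (z + 1); rewrite wz addrCA; congr (_ + _).
    by rewrite mulrzDr mulr1z addrC.
  rewrite add_lfunE wz => ewk; exists (z - 1); rewrite mulrzBr mulr1z addrA.
  by apply/eqP; rewrite eq_sym subr_eq ewk addrC.
have [z zE] : exists z : 'I_n -> int, forall k, connect e i k ->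
    (w k h : K) = (w i h : K) + (alpha h : K) *~ z k.
  apply: (@fin_all_exists _ _ (fun k z => connect e i k ->
    (w k h : K) = (w i h : K) + (alpha h : K) *~ z)) => k.
  by case: (boolP (connect e i k)) => [/shift[z ?]|_]; [exists z | exists 0].
(* Each weight on the string is [w i] plus z k times [alpha]; summing their values at h gives the
   vanishing trace. *)
exists #|connect e i|, (- \sum_(k | connect e i k) z k); split.
  by apply/card_gt0P; exists i; apply: connect0.
have : \sum_(k | connect e i k) (w k h : K) = 0.
  rewrite -[RHS]tr0 big_mkcond; apply: eq_bigr => k _.
  rewrite mul_mx_diag mxE adM_torus eqxx [c 0 k]mxE.
  by case: ifP => _; rewrite ?mulr1 ?mulr0.
rewrite (eq_bigr (fun k => (w i h : K) + (alpha h : K) *~ z k)) //.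
rewrite big_split /= sumr_const -mulrz_sumr => /eqP; rewrite addr_eq0 => /eqP ->.
by rewrite mulrNz.
Qed.


Lemma torus_central_commutator x y (h : lie_sub t) :
  vsval h = lie x y -> (forall i, w i h = 0 :> K) -> lie x y = 0.
Proof.
move=> hE w0; apply: central_commutator_eq0 => // z.
rewrite -hE lieC; apply/eqP; rewrite oppr_eq0; apply/eqP/eq_coord => i.
by rewrite coord_lie_torus w0 mul0r linear0.
Qed.

Definition killing_radical x := forall y, killing x y = 0.

Lemma killing_radical_lie x y : killing_radical x -> killing_radical (lie x y).
Proof. by move=> radx z; rewrite killing_lie radx. Qed.

Lemma vsval_coroot (alpha : weight) x y :
  x \in rootspace alpha -> y \in rootspace (- alpha) ->
  vsval (vsproj t (lie x y) : lie_sub t) = lie x y.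
Proof.
move=> xa ya; apply: vsprojK; rewrite -rootspace0_torus -(subrr alpha).
exact: lie_rootspace.
Qed.

(* By rationality of the weights on [lie x y], its Killing norm, a sum of
   squares, cannot vanish unless all the weights do. *)
Lemma radical_coroot_eq0 (alpha : weight) x y :
  killing_radical x -> x \in rootspace alpha -> y \in rootspace (- alpha) ->
  lie x y = 0.
Proof.
move=> radx xa ya; pose h : lie_sub t := vsproj t (lie x y).
have hE : vsval h = lie x y by exact: vsval_coroot xa ya.
apply: (torus_central_commutator hE).
have sq0 : \sum_i (w i h : K) ^+ 2 = 0.
  by rewrite -killing_torus hE; apply: killing_radical_lie.
have [m mE] := fin_all_exists (fun i => coroot_rational i xa ya hE).
have [z zE] := fin_all_exists mE.
(* [M] is a common denominator and the [N i] are the numerators. The sum of squares becomes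
   alpha(h)^2 times a sum of squares of integers, where positivity is available although K carries
   no order. *)
pose M := (\prod_j m j)%N; pose N i := z i * (\prod_(j | j != i) m j)%N%:Z.
have nzM : M%:R != 0 :> K.
  by rewrite natK_eq0 -lt0n prodn_gt0 // => i; case: (zE i).
have wM i : (w i h : K) * M%:R = (alpha h : K) * (N i)%:~R.
  have [_ wi] := zE i.
  rewrite /M (bigD1 i) //= natrM mulrA [_ * (m i)%:R]mulr_natr wi /N intrM -mulrzr -mulrA.
  by rewrite -[in RHS]pmulrn.
have : (alpha h : K) ^+ 2 * (\sum_i (N i) ^+ 2)%:~R = 0.
  transitivity ((\sum_i (w i h : K) ^+ 2) * M%:R ^+ 2); last by rewrite sq0 mul0r.
  rewrite mulr_suml (raddf_sum (intr : int -> K)) mulr_sumr /=; apply: eq_bigr => i _.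
  by rewrite -exprMn wM [N i ^+ 2]expr2 intrM [RHS]expr2 mulrACA -expr2.
move/eqP; rewrite mulf_eq0 expf_eq0 /= => /orP[/eqP a0|].
  move=> i; have [m_gt0] := zE i; rewrite a0 mul0rz => /eqP.
  by rewrite -mulr_natr mulf_eq0 natK_eq0 eqn0Ngt m_gt0 orbF => /eqP.
have sum_ge0 : 0 <= \sum_i N i ^+ 2 by apply: sumr_ge0 => i _; apply: sqr_ge0.
rewrite -(gez0_abs sum_ge0) -pmulrn natK_eq0 absz_eq0.
rewrite psumr_eq0 => [/allP N0 i|i _]; last exact: sqr_ge0.
have := N0 i (mem_index_enum i); rewrite expf_eq0 /= => /eqP Ni0.
have /eqP := wM i; rewrite Ni0 mulr0 mulf_eq0 (negPf nzM) orbF => /eqP; exact.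
Qed.

Lemma killing_b_orth (i j : 'I_n) : w i + w j != 0 -> killing b`_i b`_j = 0.
Proof. by apply: contraNeq => nz; apply/eqP; apply: killing_orth nz. Qed.

Lemma killing_wcomp (P : pred weight) x (j : 'I_n) :
  killing (wcomp P x) b`_j = if P (- w j) then killing x b`_j else 0.
Proof.
have e (i : 'I_n) : P (w i) != P (- w j) -> killing b`_i b`_j = 0.
  by move=> ne; apply: killing_b_orth; apply: contra ne; rewrite addr_eq0 => /eqP ->.
rewrite [in RHS](coE x) /wcomp !killing_suml big_mkcond /=.
case: ifP => Pj; [apply: eq_bigr => i _ | apply: big1 => i _].
  by case: ifP => // Pi; rewrite killingZl e ?mulr0 // Pi Pj.
by case: ifP => // Pi; rewrite killingZl e ?mulr0 // Pi Pj.
Qed.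

Lemma killing_radicalP x : (forall j : 'I_n, killing x b`_j = 0) -> killing_radical x.
Proof.
move=> x0 y; rewrite (coE y) killing_sumr big1 // => j _.
by rewrite killingZr x0 mulr0.
Qed.

Lemma killing_radical_wcomp P x : killing_radical x -> killing_radical (wcomp P x).
Proof.
by move=> radx; apply: killing_radicalP => j; rewrite killing_wcomp radx if_same.
Qed.

(** Both conditions, lying in the Killing radical and having no torus part, are put into one linear
    map so that its kernel is a subspace to which [reductive] can be applied. *)
Let rad_map (x : g) : 'rV[K]_n * g := (\row_j killing x b`_j, wcomp (pred1 0) x).

Fact rad_map_linear : linear rad_map.
Proof.
move=> a x y; apply/eqP; rewrite xpair_eqE /= linearP eqxx andbT.
by apply/eqP/rowP => j; rewrite !mxE /killing linearP mulmxDl -scalemxAl linearP.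
Qed.
HB.instance Definition _ := GRing.isLinear.Build K g _ _ rad_map rad_map_linear.

Let rad_roots : {vspace g} := lker (linfun rad_map).

Let rad_rootsP x : reflect (killing_radical x /\ forall i, w i = 0 -> co i x = 0)
  (x \in rad_roots).
Proof.
rewrite memv_ker lfunE /= xpair_eqE; apply: (iffP andP) => [[/eqP kx /eqP x0]|[radx x0]].
  split=> [|i wi0].
    by apply: killing_radicalP => j; have /rowP/(_ j) := kx; rewrite !mxE.
  by have := coord_wcomp (pred1 0) i x; rewrite x0 linear0 /= wi0 eqxx.
split; first by apply/eqP/rowP => j; rewrite !mxE radx.
apply/eqP/eq_coord => i; rewrite coord_wcomp linear0; case: ifP => //= /eqP.
exact: x0.
Qed.

(** A torus part can only arise from brackets of opposite weights, and for vectors of the radical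
    these vanish by [radical_coroot_eq0]. *)
Let rad_roots_ideal : lie_ideal rad_roots.
Proof.
move=> y x /rad_rootsP[radx x0].
have radyx : killing_radical (lie y x).
  by move=> z; rewrite lieC -scaleN1r killingZl killing_radical_lie ?mulr0.
apply/rad_rootsP; split=> // i wi0.
rewrite (coE y) lie_suml linear_sum big1 // => j _; rewrite lieZl linearZ /=.
have -> : co i (lie b`_j x) = co i (lie b`_j (wcomp (pred1 (- w j)) x)).
  rewrite {1}(coE x) /wcomp [in RHS]big_mkcond /= !lie_sumr !linear_sum.
  apply: eq_bigr => k _; case: eqP => // ne; rewrite lieZr linearZ lie0r linear0 /=.
  rewrite (coord_rootspace0 (lie_rootspace (b_weight j) (b_weight k))) ?mulr0 //.
  by rewrite wi0 eq_sym addrC addr_eq0; apply/eqP.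
have [wj0|nz] := eqVneq (w j) 0.
  have -> : wcomp (pred1 (- w j)) x = 0.
    apply: eq_coord => k; rewrite coord_wcomp linear0 wj0 oppr0 /=.
    by case: eqP => // /x0.
  by rewrite lie0r linear0 mulr0.
rewrite lieC (@radical_coroot_eq0 (- w j)) ?oppr0 ?linear0 ?mulr0 //.
- exact: killing_radical_wcomp.
- exact: wcomp1_rootspace.
- by rewrite opprK.
Qed.

(** Split a torus element h along the ideal [rad_roots] and a complementary ideal. The complement
    commutes with e, and the other summand has no torus part, so its bracket with e has no component
    of weight [alpha]. Hence alpha(h) = 0 for every h unless e = 0. *)
Lemma radical_root_eq0 (alpha : weight) e : alpha != 0 ->
  e \in rootspace alpha -> killing_radical e -> e = 0.
Proof.
move=> nza ea rade.
have eR : e \in rad_roots.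
  apply/rad_rootsP; split=> // i wi0; apply: (coord_rootspace0 ea).
  by rewrite wi0 eq_sym.
have [J [idJ RJ RJ0]] := g_reductive rad_roots_ideal.
apply: eq_coord => i; rewrite linear0; apply/eqP; apply: contraNT nza => nzi.
apply/eqP/lfunP => h; rewrite zero_lfunE; apply/eqP.
have := memvf (vsval h); rewrite -RJ => /memv_addP[r /rad_rootsP[_ r0] [j jJ hE]].
have := congr1 (co i) (rootspaceP _ _ ea h); rewrite hE lieDl [lie j e]lieC.
rewrite (ideals_lie0 rad_roots_ideal idJ RJ0 eR jJ) oppr0 addr0 linearZ /=.
rewrite {1}(coE r) lie_suml linear_sum big1 => [/esym/eqP|k _ /=].
  by rewrite mulf_eq0 (negPf nzi) orbF.
rewrite lieZl linearZ /=; have [/r0->|nzk] := eqVneq (w k) 0; first by rewrite mul0r.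
rewrite (coord_rootspace0 (lie_rootspace (b_weight k) ea)) ?mulr0 //.
rewrite (coord_rootspace ea nzi) -subr_eq0 opprD addrA addrAC subrr sub0r oppr_eq0.
exact: nzk.
Qed.

Lemma radical_roots_eq0 x :
  killing_radical x -> (forall i, w i = 0 -> co i x = 0) -> x = 0.
Proof.
move=> radx x0; apply: eq_coord => i; rewrite linear0.
have [/x0//|nz] := eqVneq (w i) 0.
have := coord_wcomp (pred1 (w i)) i x; rewrite /= eqxx => <-.
rewrite (@radical_root_eq0 (w i) (wcomp (pred1 (w i)) x)) ?linear0 //.
  exact: wcomp1_rootspace.
exact: killing_radical_wcomp.
Qed.

(** If a weight were non-zero at h, its basis vector would be a multiple of its own bracket with h
    and so lie in the radical. Thus all weights vanish at h, and h is a central commutator. *)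
Lemma radical_torus_commutator x y (h : lie_sub t) : vsval h = lie x y ->
  killing_radical (lie x y) -> lie x y = 0.
Proof.
move=> hE radh; apply: (torus_central_commutator hE) => i; apply/eqP.
have [->|nz] := eqVneq (w i) 0; first by rewrite zero_lfunE.
apply/negPn/negP => nzh.
have radb : killing_radical b`_i.
  move=> z; apply: (mulfI nzh); rewrite mulr0 -killingZl -lie_weight hE.
  exact: killing_radical_lie.
have := co_b i i; rewrite (radical_root_eq0 nz (b_weight i) radb) linear0 eqxx.
by move/eqP; rewrite eq_sym oner_eq0.
Qed.

Lemma dual_family : exists x : 'I_n -> g, forall i, w i != 0 ->
  x i \in rootspace (- w i) /\ forall k, w k != 0 -> killing (x i) b`_k = (i == k)%:R.
Proof.
(* The Gram matrix of the root vectors, padded by the identity on the indices of weight 0 so that it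
   can be inverted without reindexing. *)
pose G : 'M[K]_n := \matrix_(j, k) (if (w j == 0) || (w k == 0) then (j == k)%:R
  else killing b`_j b`_k).
have GE (v : 'rV_n) k : w k != 0 ->
    (v *m G) 0 k = killing (\sum_(j | w j != 0) v 0 j *: b`_j) b`_k.
  move=> nzk; rewrite mxE killing_suml [RHS]big_mkcond /=; apply: eq_bigr => j _.
  rewrite mxE killingZl (negPf nzk) orbF; case: eqP => [wj0|//] /=.
  by case: eqP => [ejk|]; rewrite ?mulr0 //; rewrite -ejk wj0 eqxx in nzk.
have G_unit : G \in unitmx.
  rewrite -row_free_unit; apply/row_freeP; apply/row_freeP.
  rewrite -kermx_eq0; apply/rowV0P => v /sub_kermxP vG.
  have v0 k : w k = 0 -> v 0 k = 0.
    move=> wk0; have /rowP/(_ k) := vG; rewrite !mxE (bigD1 k) //= big1 => [|j ne_jk].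
      by rewrite mxE wk0 !eqxx /= mulr1 addr0.
    by rewrite mxE wk0 eqxx orbT (negPf ne_jk) mulr0.
  pose x := \sum_(j | w j != 0) v 0 j *: b`_j.
  have cox k : co k x = if w k != 0 then v 0 k else 0.
    rewrite /x linear_sum; case: ifP => nzk.
      rewrite (bigD1 k) //= big1 => [|j /andP[_ ne_jk]].
        by rewrite linearZ /= co_b eqxx mulr1 addr0.
      by rewrite linearZ /= co_b eq_sym (negPf ne_jk) mulr0.
    rewrite big1 // => j nzj; rewrite linearZ /= co_b.
    by case: eqP => [e|]; rewrite ?mulr0 //; rewrite -e nzk in nzj.
  have x0 : x = 0.
    apply: radical_roots_eq0 => [|i wi0]; last by rewrite cox wi0 eqxx.
    apply: killing_radicalP => k; have [wk0|nzk] := eqVneq (w k) 0.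
      rewrite killing_suml big1 // => j nzj; rewrite killingZl killing_b_orth ?mulr0 //.
      by rewrite wk0 addr0.
    by rewrite -GE // vG mxE.
  apply/rowP => k; rewrite mxE; have [/v0//|nzk] := eqVneq (w k) 0.
  by have := cox k; rewrite x0 linear0 nzk.
pose y i := \sum_(j | w j != 0) (invmx G) i j *: b`_j.
(* Keeping only the component of weight [- w i] changes no pairing with a basis vector of weight
   [w i]; the other pairings become zero, as duality requires of them anyway. *)
exists (fun i => wcomp (pred1 (- w i)) (y i)) => i nzi; split.
  exact: wcomp1_rootspace.
move=> k nzk; rewrite killing_wcomp /= eqr_opp.
have yk : killing (y i) b`_k = (i == k)%:R.
  have := GE (row i (invmx G)) k nzk; rewrite -row_mul mulVmx // row1 mxE eqxx.
  rewrite eq_sym /= => ->; congr (killing _ _).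
  by apply: eq_bigr => j _; rewrite mxE.
rewrite yk; case: eqVneq => // ne; case: eqP => // e.
by rewrite e eqxx in ne.
Qed.

Lemma killing_lie_torus (alpha : weight) x y (h : lie_sub t) :
  y \in rootspace alpha -> killing (lie x y) (vsval h) = - ((alpha h : K) * killing x y).
Proof.
move=> /rootspaceP ya; rewrite killing_lie [lie y _]lieC ya.
by rewrite -scaleNr killingZr mulNr.
Qed.

(** By [killing_lie_torus] the bracket is orthogonal to the torus, and by its weight to all root
    vectors. It is therefore a torus commutator in the radical. *)
Lemma killing_orth_lie_eq0 (alpha : weight) x y : x \in rootspace (- alpha) ->
  y \in rootspace alpha -> killing x y = 0 -> lie x y = 0.
Proof.
move=> xa ya kxy; have xy0 : lie x y \in rootspace (0 : weight).
  by rewrite -(addNr alpha); apply: lie_rootspace.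
have yNa : y \in rootspace (- - alpha) by rewrite opprK.
apply: (radical_torus_commutator (vsval_coroot xa yNa)).
apply: killing_radicalP => j; have [wj0|nzj] := eqVneq (w j) 0.
  have := killing_lie_torus x (vsproj t b`_j) ya; rewrite vsprojK ?b_zero //.
  by rewrite kxy mulr0 oppr0.
apply: contraNeq nzj => nz; apply/eqP.
by have := killing_orth xy0 (b_weight j) nz; rewrite add0r.
Qed.

(** This stands in for the formula giving [x, y] as the Killing form times a fixed coroot. Vectors
    of distinct weights have no torus part in their bracket, orthogonal ones of equal weight bracket
    to 0; and [h i] is non-zero since it pairs with the torus as [- w i]. *)
Lemma dual_root_vectors : exists x h : 'I_n -> g, forall i, w i != 0 ->
  [/\ x i \in rootspace (- w i), h i != 0
    & forall k, w k != 0 -> wcomp (pred1 0) (lie (x i) b`_k) = (i == k)%:R *: h i].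
Proof.
have [x xP] := dual_family; exists x, (fun i => lie (x i) b`_i) => i nzi.
have [xi kxi] := xP i nzi; split=> // [|k nzk].
  have kii : killing (x i) b`_i = 1 by rewrite kxi // eqxx.
  apply: contraNneq nzi => h0; apply/eqP/lfunP => h; rewrite zero_lfunE.
  have := killing_lie_torus (x i) h (b_weight i); rewrite h0 kii mulr1.
  by rewrite -(scale0r 0) killingZl mul0r => /esym/eqP; rewrite oppr_eq0 => /eqP.
rewrite (wcomp_rootspace _ (lie_rootspace xi (b_weight k))) /=.
rewrite addrC subr_eq0; case: eqVneq => [ek|ne_k]; last first.
  by case: eqP => [ik|_]; rewrite ?scale0r //; rewrite ik eqxx in ne_k.
case: eqVneq => [->|ne_ik]; first by rewrite scale1r.
rewrite scale0r; apply: (@killing_orth_lie_eq0 (w i)) => //; first by rewrite -ek.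
by rewrite kxi // (negPf ne_ik).
Qed.

End WeightBasis.

(** * Invariants restricted to the torus and to a Borel subalgebra *)

Lemma mem_sumv_seq (K : fieldType) (V : vectType K) (I : eqType) (s : seq I)
    (f : I -> {vspace V}) i v :
  i \in s -> v \in f i -> v \in (\sum_(j <- s) f j)%VS.
Proof. by move=> si; rewrite (big_rem i) //=; apply/subvP/addvSl. Qed.

Section TriangularRestriction.
Variables (K : fieldType) (g : lieAlgType K) (t : lieSubalg g).
Hypothesis K0 : [pchar K] =i pred0.
Hypothesis g_reductive : reductive g.
Hypothesis t_nilpotent : lie_nilpotent t.
Variables up um : {vspace g}.
Hypothesis tri : triangular_decomposition t up um.
Local Notation weight := 'Hom(lie_sub t, K^o).

Fact proj_t_linear : linear (proj_t t up um).
Proof. by move=> a x y; rewrite /proj_t !linearP. Qed.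
HB.instance Definition _ :=
  GRing.isLinear.Build K g (lie_sub t) _ (proj_t t up um) proj_t_linear.

Let tabel := torus_abelian g_reductive t_nilpotent tri.

Let t_cap_u : (t :&: (up + um) = 0)%VS.
Proof.
have [Dp [_ _ _ _]] := tri; rewrite !directv_addE !directv_trivial /=.
case/andP=> /eqP ut0 /eqP utm0; apply/eqP; rewrite -subv0; apply/subvP => x.
rewrite memv_cap => /andP[xt /memv_addP[a au [c cm xE]]].
have c0 : c = 0.
  apply/eqP; rewrite -memv0 -utm0 memv_cap cm andbT.
  have -> : c = - a + x by rewrite xE addKr.
  by apply: memv_add => //; rewrite memvN.
by rewrite -ut0 memv_cap xt andbT xE c0 addr0.
Qed.

Lemma proj_t_torus x : x \in lieSubalg_vs t -> vsval (proj_t t up um x) = x.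
Proof. by move=> xt; rewrite /proj_t daddv_pi_id // vsprojK. Qed.

Lemma proj_t_roots x : x \in (up + um)%VS -> proj_t t up um x = 0.
Proof.
move=> xu; rewrite /proj_t; have := daddv_pi_add t_cap_u.
move=> /(_ x); rewrite (subvP (addvSr _ _) _ xu) => /(_ isT).
rewrite (daddv_pi_id (U := (up + um)%VS)) //; last by rewrite capvC.
by rewrite -[RHS]add0r => /addIr ->; rewrite linear0.
Qed.

(** Bases of the root spaces and of t are concatenated and then thinned out, so the independence of
    the root spaces need not be established first. *)
Lemma weight_basis_exists :
  exists (Dp : seq weight) (n : nat) (b : n.-tuple g) (w : 'I_n -> weight),
  [/\ positive_system Dp, basis_of {:g} b &
    forall i : 'I_n, b`_i \in rootspace (w i) /\
     [\/ w i = 0 /\ b`_i \in lieSubalg_vs t,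
         w i \in Dp /\ b`_i \in up | - w i \in Dp /\ b`_i \in um]].
Proof.
have [Dp [posDp upE umE full_g _]] := tri.
pose s := flatten [seq vbasis (rootspace alpha) : seq g | alpha <- Dp] ++ vbasis t
  ++ flatten [seq vbasis (rootspace (- alpha)) : seq g | alpha <- Dp].
have span_s : <<s>>%VS = fullv.
  rewrite /s !span_cat -full_g upE umE addvA (span_basis (vbasisP _)).
  have span_flat (f : weight -> {vspace g}) :
      <<flatten [seq vbasis (f alpha) : seq g | alpha <- Dp]>>%VS = (\sum_(alpha <- Dp) f alpha)%VS.
    elim: Dp {posDp upE umE s full_g} => [|a Dp IH] /=; first by rewrite span_nil big_nil.
    by rewrite span_cat IH big_cons (span_basis (vbasisP _)).
  by rewrite !span_flat.
have sP x : x \in s -> exists wx : weight, x \in rootspace wx /\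
     [\/ wx = 0 /\ x \in lieSubalg_vs t, wx \in Dp /\ x \in up | - wx \in Dp /\ x \in um].
  rewrite !mem_cat => /or3P[/flattenP[_ /mapP[a aD ->] xa]|xt|/flattenP[_ /mapP[a aD ->] xa]].
  - exists a; split; first exact: vbasis_mem.
    constructor 2; split=> //; rewrite upE.
    by apply: (mem_sumv_seq aD); apply: vbasis_mem.
  - exists 0; split; last by constructor 1; split=> //; apply: vbasis_mem.
    apply/rootspaceP => h; rewrite zero_lfunE scale0r; apply: tabel; first exact: subvsP.
    exact: vbasis_mem.
  - exists (- a); rewrite opprK; split; first exact: vbasis_mem.
    constructor 3; split=> //; rewrite umE.
    by apply: (mem_sumv_seq aD); apply: vbasis_mem.
have [b [free_b span_b sub_b]] := extract_basis s.
have /fin_all_exists[w wP] : forall i : 'I_(size b), exists wx : weight, b`_i \in rootspace wx /\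
     [\/ wx = 0 /\ b`_i \in lieSubalg_vs t, wx \in Dp /\ b`_i \in up | - wx \in Dp /\ b`_i \in um].
  by move=> i; apply/sP/sub_b/mem_nth.
exists Dp, (size b), (in_tuple b), w; split=> //.
by rewrite basisEfree free_b subvf /= -span_s -span_b (eqnP free_b).
Qed.


Lemma linear_basis_eq (W : vectType K) n (b : n.-tuple g) (f1 f2 : {linear g -> W}) :
  basis_of {:g} b -> (forall i : 'I_n, f1 b`_i = f2 b`_i) -> f1 =1 f2.
Proof.
move=> bb f12 v; rewrite (coord_basis bb (memvf v)) !linear_sum.
by apply: eq_bigr => i _; rewrite !linearZ f12.
Qed.

Section Restriction.
Variables (Dp : seq weight) (n : nat) (b : n.-tuple g) (w : 'I_n -> weight).
Hypothesis posDp : positive_system Dp.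
Hypothesis b_basis : basis_of {:g} b.
Hypothesis b_split : forall i : 'I_n, b`_i \in rootspace (w i) /\
     [\/ w i = 0 /\ b`_i \in lieSubalg_vs t,
         w i \in Dp /\ b`_i \in up | - w i \in Dp /\ b`_i \in um].

Let Dp_neq0 a : a \in Dp -> a != 0.
Proof. by have [_ rt _ _] := posDp; move=> /rt /andP[]. Qed.

Let Dp_notopp a : a \in Dp -> - a \notin Dp.
Proof.
have [_ rt xor _] := posDp => aD; have := xor a (rt a aD).
by rewrite aD /=.
Qed.

Let zero_notin : (0 : weight) \notin Dp.
Proof. by apply/negP => /Dp_neq0; rewrite eqxx. Qed.

Let b_weight (i : 'I_n) : b`_i \in rootspace (w i).
Proof. by case: (b_split i). Qed.

Let b_zero (i : 'I_n) : w i = 0 -> b`_i \in lieSubalg_vs t.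
Proof.
move=> wi0; case: (b_split i) => _ [[//]|[wD _]|[wD _]]; rewrite wi0 ?oppr0 in wD;
by have := zero_notin; rewrite wD.
Qed.

Local Notation wc := (wcomp b w).
Let wc_b P (i : 'I_n) : wc P b`_i = if P (w i) then b`_i else 0.
Proof. exact: wcomp_rootspace. Qed.

Let p : {linear g -> g} := wc (pred1 0).

Lemma proj_t_wcomp v : vsval (proj_t t up um v) = p v.
Proof.
move: v; apply: (linear_basis_eq (f1 := vsval \o proj_t t up um) b_basis) => i /=.
rewrite wc_b /=; case: (b_split i) => _ [[-> bt]|[/Dp_neq0/negPf-> bu]|[wD bu]].
- by rewrite eqxx proj_t_torus.
- by rewrite proj_t_roots ?linear0 // (subvP (addvSl _ _)).
- rewrite proj_t_roots ?linear0 ?(subvP (addvSr _ _)) //.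
  by have := Dp_neq0 wD; rewrite oppr_eq0 => /negPf->.
Qed.


(** The dual vector of a basis vector of weight [a] lies in the opposite root space, and it is
    non-zero because the bracket [h i] is. *)
Lemma is_root_opp_basis (a : weight) : is_root a -> is_root (- a).
Proof.
case/andP=> nza; rewrite -vpick0 => nze; rewrite /is_root oppr_eq0 nza /=.
have ea := memv_pick (rootspace a); set e := vpick _ in nze ea.
have [i nzi] : exists i : 'I_n, coord b i e != 0.
  apply/existsP; rewrite -negb_forall; apply: contra nze => /forallP e0.
  rewrite (coord_basis b_basis (memvf e)) big1 // => i _.
  by rewrite (eqP (e0 i)) scale0r.
have wi := coord_rootspace b_basis b_weight ea nzi.
have [x [h xhP]] := dual_root_vectors K0 g_reductive tabel b_basis b_weight b_zero.
have [|xi nzh xk] := xhP i; first by rewrite wi.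
apply: contraNneq nzh => r0; have := xk i; rewrite wi eqxx scale1r => <- //.
by move: xi; rewrite wi r0 memv0 => /eqP->; rewrite lie0l linear0.
Qed.

Let pP (a : weight) x : x \in rootspace a -> p x = if a == 0 then x else 0.
Proof. exact: wcomp_rootspace. Qed.

Let coord_p v i : coord b i (p v) = if w i == 0 then coord b i v else 0.
Proof. exact: coord_wcomp. Qed.

Section SelectedRoots.
Variable P : pred weight.
Hypothesis P0 : ~~ P 0.
Let q : {linear g -> g} := wc P.

Let qP (a : weight) x : x \in rootspace a -> q x = if P a then x else 0.
Proof. exact: wcomp_rootspace. Qed.

Let coord_q v i : coord b i (q v) = if P (w i) then coord b i v else 0.
Proof. exact: coord_wcomp. Qed.

Hypothesis P_lie : forall i k : 'I_n, P (w i) -> w k != 0 -> ~~ P (w k) ->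
  forall x, x \in rootspace (- w i) -> q (lie x b`_k) = 0.

Let lie_weights (i k : 'I_n) x : x \in rootspace (- w i) ->
  lie x b`_k \in rootspace (- w i + w k).
Proof. by move=> xi; apply: lie_rootspace. Qed.

(** Applied to all roots, where the first alternative says that F restricts to 0 on t, and to the
    negative roots, where the second holds. [P_lie] keeps unselected root vectors from producing
    selected ones. *)
Lemma selected_pencil_coef F : sym_invariant F ->
  (pencil p q F)`_0 = 0 \/ (forall a, P a -> ~~ P (- a)) ->
  forall m, (pencil p q F)`_m.+1 = 0.
Proof.
move=> invF F0.
have [x [h xhP]] := dual_root_vectors K0 g_reductive tabel b_basis b_weight b_zero.
have nzP i : P (w i) -> w i != 0 by move=> Pi; apply: contraNneq P0 => <-.
have pp v : p (p v) = p v.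
  by apply: (eq_coord b_basis) => i; rewrite !coord_p; case: (w i == 0).
have qq v : q (q v) = q v.
  by apply: (eq_coord b_basis) => i; rewrite !coord_q; case: (P _).
have pq v : p (q v) = 0.
  apply: (eq_coord b_basis) => i; rewrite coord_p coord_q linear0.
  by case: eqP => // ->; rewrite (negPf P0).
have qp v : q (p v) = 0.
  apply: (eq_coord b_basis) => i; rewrite coord_q coord_p linear0.
  by case: eqP => [->|_]; [rewrite (negPf P0)|rewrite if_same].
apply: (invariant_pencil_coef (Q := fun i => P (w i)) K0 pp qq pq qp (x := x)
  (e := fun i => b`_i) (h := h) (phi := fun i => coord b i)) => //.
- move=> i v Pi; have [xi _ xk] := xhP i (nzP i Pi).
  move: v; apply: (linear_basis_eq (f1 := p \o lie (x i))
     (f2 := p \o (lie (x i) \o q)) b_basis) => k /=.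
  rewrite (qP (b_weight k)); case: ifP => // nPk; rewrite lie0r linear0.
  have [wk0|nzk] := eqVneq (w k) 0.
    by rewrite (pP (lie_weights k xi)) wk0 addr0 oppr_eq0 (negPf (nzP i Pi)).
  rewrite (pP (lie_weights k xi)) addrC subr_eq0; case: eqP => // e.
  by rewrite e Pi in nPk.
- move=> i v Pi; have [xi _ xk] := xhP i (nzP i Pi).
  move: v; apply: (linear_basis_eq (f1 := q \o lie (x i))
     (f2 := (q \o (lie (x i) \o q)) \+ (q \o (lie (x i) \o p))) b_basis) => k /=.
  rewrite (qP (b_weight k)) (pP (b_weight k)).
  have [wk0|nzk] := eqVneq (w k) 0.
    by rewrite wk0 (negPf P0) lie0r linear0 add0r.
  rewrite lie0r linear0 addr0; case: ifP => // /negbT nPk.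
  by rewrite lie0r linear0 (P_lie Pi).
- by move=> i Pi; have [] := xhP i (nzP i Pi).
- move=> i v Pi; have [xi _ xk] := xhP i (nzP i Pi).
  have -> : q v = \sum_(k | P (w k)) coord b k v *: b`_k by [].
  rewrite lie_sumr (linear_sum p) (bigD1 i) //= big1 => [|k /andP[Pk ne_ki]].
    by rewrite lieZr linearZ /= [p _]xk ?nzP // eqxx scale1r addr0.
  by rewrite lieZr linearZ /= [p _]xk ?nzP // eq_sym (negPf ne_ki) scale0r scaler0.
case: F0 => [|PN]; [by left|right] => i v Pi.
have [xi _ _] := xhP i (nzP i Pi).
move: v; apply: (linear_basis_eq (f1 := q \o (lie (x i) \o p)) (f2 := \0) b_basis) => k /=.
rewrite (pP (b_weight k)); case: eqP => [wk0|_]; last by rewrite lie0r linear0.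
by rewrite (qP (lie_weights k xi)) wk0 addr0 (negPf (PN _ Pi)).
Qed.

End SelectedRoots.

(** With all roots selected, p + q is the identity, so F is the value at X = 1 of a pencil all of
    whose coefficients vanish. *)
Lemma chevalley_basis F : sym_invariant F -> restr_t t up um F = 0 -> F = 0.
Proof.
move=> invF F0; pose q : {linear g -> g} := wc (predC1 0).
have pF0 : sym_map p F = 0.
  rewrite (eq_sym_map (psi := vsval \o proj_t t up um)); last first.
    by move=> v; rewrite /= proj_t_wcomp.
  by rewrite -(sym_map_comp _ (proj_t t up um)) [sym_map _ F]F0 rmorph0.
have c0 : (pencil p q F)`_0 = 0 by rewrite pencil_coef0.
have P0 : ~~ predC1 (0 : weight) 0 by rewrite /= eqxx.
have cn : forall m, (pencil p q F)`_m.+1 = 0.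
  apply: selected_pencil_coef => //; last by left.
  by move=> i k _ nzk; rewrite /= nzk.
have : pencil p q F = 0 by apply/polyP => -[|m]; rewrite coef0 // cn.
move/(congr1 (fun G => G.[1])); rewrite horner0 pencil_horner1 sym_map_id // => v.
apply: (eq_coord b_basis) => i; change (coord b i (p v + q v) = coord b i v).
rewrite linearD /= coord_p [coord b i (q v)](coord_wcomp w b_basis) /=.
by case: (w i == 0); rewrite ?addr0 ?add0r.
Qed.

Lemma opposite_borel_basis : exists q u : {linear g -> g},
  [/\ forall v, v = u v + vsval (proj_t t up um v) + q v,
      forall v, u v \in up, forall v, q v \in um
    & forall F, sym_invariant F ->
      sym_map ((vsval \o proj_t t up um) \+ q) F = sym_map (vsval \o proj_t t up um) F].
Proof.
pose P : pred weight := [pred a | - a \in Dp].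
pose q : {linear g -> g} := wc P; pose u : {linear g -> g} := wc (mem Dp).
have PE a : P a = (- a \in Dp) by [].
exists q, u; split=> [v|v|v|F invF].
- rewrite proj_t_wcomp; apply: (eq_coord b_basis) => i.
  rewrite !linearD /= coord_p [coord b i (q v)](coord_wcomp w b_basis).
  rewrite [coord b i (u v)](coord_wcomp w b_basis) PE /=.
  case: (b_split i) => _ [[-> _]|[wD _]|[wD _]].
  + by rewrite oppr0 (negPf zero_notin) eqxx add0r addr0.
  + by rewrite wD (negPf (Dp_notopp wD)) (negPf (Dp_neq0 wD)) !addr0.
  + rewrite wD; have := Dp_notopp wD; rewrite opprK => /negPf->.
    by have := Dp_neq0 wD; rewrite oppr_eq0 => /negPf->; rewrite !add0r.
- apply: memv_suml => i iD0; have iD : w i \in Dp := iD0.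
  apply: memvZ; case: (b_split i) => _ [[wi0 _]|[_ //]|[wD _]].
    by have := zero_notin; rewrite -wi0 iD.
  by have := Dp_notopp wD; rewrite opprK iD.
- apply: memv_suml => i iD0; have iD : - w i \in Dp := iD0.
  apply: memvZ; case: (b_split i) => _ [[wi0 _]|[wD _]|[_ //]].
    by have := zero_notin; rewrite -oppr0 -wi0 iD.
  by have := Dp_notopp wD; rewrite iD.
have ep : p =1 vsval \o proj_t t up um by move=> v; rewrite /= proj_t_wcomp.
have cn : forall m, (pencil p q F)`_m.+1 = 0.
  apply: selected_pencil_coef => //.
  - by rewrite PE oppr0.
  (* Both [- w i] and [w k] are positive. A non-zero bracket makes their sum a positive root if that
     sum is non-zero, so it cannot be a selected, negative one. *)
  - move=> i k Pi nzk nPk x xi; have wkD : w k \in Dp.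
      by case: (b_split k) => _ [[wk0 _]|[//]|[wD _]];
        [rewrite wk0 eqxx in nzk | rewrite PE wD in nPk].
    have xk := lie_rootspace xi (b_weight k).
    have [-> |nz] := eqVneq (lie x b`_k) 0; first exact: linear0.
    have [_ _ xor add] := posDp.
    rewrite [LHS](wcomp_rootspace b_basis b_weight _ xk) /=; case: ifP => // bD.
    have rt : is_root (- w i + w k).
      rewrite /is_root; have := Dp_neq0 bD; rewrite oppr_eq0 => -> /=.
      by apply: contraNneq nz => r0; rewrite r0 memv0 in xk.
    have := add _ _ Pi wkD rt.
    by have := Dp_notopp bD; rewrite opprK => /negPf->.
  - right=> a /= aD; exact: Dp_notopp.
rewrite -(eq_sym_map ep) -(pencil_coef0 p q).
rewrite (eq_sym_map (psi := p \+ q)); last by move=> v /=; rewrite proj_t_wcomp.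
rewrite -pencil_horner1 [pencil p q F]size1_polyC ?hornerC ?coefC //.
by apply/leq_sizeP => -[|m] // _; apply: cn.
Qed.

End Restriction.

Lemma is_root_opp (a : weight) : is_root a -> is_root (- a).
Proof.
have [Dp [n [b [w [posDp bb bs]]]]] := weight_basis_exists.
exact: (is_root_opp_basis posDp bb bs).
Qed.

(** The point is that the negatives of [Dp] are roots at all. The definition of a positive system
    does not give this; it comes from [is_root_opp]. *)
Lemma triangular_decomposition_sym : triangular_decomposition t um up.
Proof.
have [Dp [[uDp rDp xDp aDp] upE umE full direct]] := tri.
have rN (a : weight) : is_root (- a) = is_root a.
  by apply/idP/idP => /is_root_opp //; rewrite opprK.
have rev_sum : (um + t + up = up + t + um)%VS.
  by rewrite addvC [(um + t)%VS]addvC addvA.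
have memN (a : weight) : (a \in [seq - x | x <- Dp]) = (- a \in Dp).
  by rewrite -{1}[a]opprK (mem_map oppr_inj).
exists [seq - a | a <- Dp]; split.
- split.
  + by rewrite (map_inj_uniq oppr_inj).
  + by move=> a; rewrite memN -rN => /rDp.
  + by move=> a /xDp; rewrite !memN opprK addbC.
  + move=> a b'; rewrite !memN -[is_root _]rN opprD; exact: aDp.
- by rewrite umE big_map.
- by rewrite upE big_map; apply: eq_bigr => a _; rewrite opprK.
- by rewrite rev_sum.
- by rewrite directvE /= rev_sum addnC [(\dim um + _)%N]addnC addnA -directvE.
Qed.

Theorem chevalley_injective F : sym_invariant F -> restr_t t up um F = 0 -> F = 0.
Proof.
have [Dp [n [b [w [posDp bb bs]]]]] := weight_basis_exists.
exact: (chevalley_basis posDp bb bs).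
Qed.

Theorem opposite_borel : exists q u : {linear g -> g},
  [/\ forall v, v = u v + vsval (proj_t t up um v) + q v,
      forall v, u v \in up, forall v, q v \in um
    & forall F, sym_invariant F ->
      sym_map ((vsval \o proj_t t up um) \+ q) F = sym_map (vsval \o proj_t t up um) F].
Proof.
have [Dp [n [b [w [posDp bb bs]]]]] := weight_basis_exists.
exact: (opposite_borel_basis posDp bb bs).
Qed.

End TriangularRestriction.

(** * Maximal components and algebraic independence *)

(** For a = -1 this is the origin of the signs [(-1) ^+ d j]. *)
Lemma sym_map_scale (K : fieldType) (V W : vectType K) (phi : {linear V -> W})
    a d F : F \is d.-homog ->
  sym_map (fun v => a *: phi v) F = a ^+ d *: sym_map phi F.
Proof.
move=> /dhomogP homF; rewrite /sym_map !comp_mpolyE scaler_sumr.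
apply: eq_big_seq => m /homF /= <-; rewrite scalerA mulrC -scalerA; congr (_ *: _).
rewrite mdegE -prodrXr -scaler_prod; apply: eq_bigr => i _.
by rewrite !tnth_mktuple linearZ exprZn.
Qed.

Section BlockJacobian.
Variables (K : fieldType) (V : vectType K) (l : nat).
Hypothesis K0 : [pchar K] =i pred0.

Lemma block_independent (A B : l.-tuple (symalg V)) (D1 D2 : 'I_l -> symalg V -> symalg V)
    (X : 'M[K]_l) :
  (forall k, derivation_along idfun (D1 k)) ->
  (forall k, derivation_along idfun (D2 k)) ->
  \det X != 0 ->
  (forall k i, D1 k (tnth A i) = (X k i)%:MP) ->
  (forall k i, D2 k (tnth A i) = 0) ->
  \det (\matrix_(k, j) D2 k (tnth B j)) != 0 ->
  alg_independent (cat_tuple A B).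
Proof.
move=> d1 d2 nzX D1A D2A nzB.
pose D (k : 'I_(l + l)) := match split k with inl i => D1 i | inr i => D2 i end.
apply: (@jacobian_independent K K0 _ _ _ D) => [k|].
  by rewrite /D; case: (split k).
rewrite (_ : \matrix_(i, j) _ = block_mx (map_mx (@mpolyC _ K) X)
   (\matrix_(k, j) D1 k (tnth B j)) 0 (\matrix_(k, j) D2 k (tnth B j))).
  by rewrite det_ublock det_map_mx mulf_neq0 // mpolyC_eq0.
have Dl a : D (lshift l a) = D1 a by rewrite /D (unsplitK (inl a)).
have Dr a : D (rshift l a) = D2 a by rewrite /D (unsplitK (inr a)).
apply/matrixP => i j; rewrite mxE.
case: (split_ordP i) => a ->; case: (split_ordP j) => c ->; rewrite ?Dl ?Dr.
- by rewrite tnth_lshift D1A block_mxEul mxE.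
- by rewrite tnth_rshift block_mxEur mxE.
- by rewrite tnth_lshift D2A block_mxEdl mxE.
- by rewrite tnth_rshift block_mxEdr mxE.
Qed.

End BlockJacobian.

(** Allows independence of the components to be proved first, and the non-vanishing that
    [max_component] demands to be read off from it. *)
Lemma alg_independent_neq0 (K : fieldType) (V : vectType K) m
    (E : m.-tuple (symalg V)) k : alg_independent E -> tnth E k != 0.
Proof.
move=> indE; apply/eqP => Ek0; have X0 : ('X_k : {mpoly K[m]}) = 0.
  by apply: indE; rewrite comp_mpolyXU -tnth_nth.
have := congr1 (mcoeff U_(k)) X0; rewrite mcoeffX eqxx mcoeff0 => /eqP.
by rewrite oner_eq0.
Qed.

(** [max_component] indexes by the degree in [r], the pencil by the degree in [h]. The lowest
    non-zero coefficient is thus the wanted component, and indices are reversed to d - i. *)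
Lemma max_component_pencil (K : fieldType) (V : vectType K) (h r : {vspace V})
    (p q : {linear V -> V}) d F k :
  (forall v, p v \in r) -> (forall v, q v \in h) -> p \+ q =1 id ->
  F \is d.-homog -> (k <= d)%N -> (pencil p q F)`_k != 0 ->
  (forall i, (i < k)%N -> (pencil p q F)`_i = 0) ->
  max_component h r F (pencil p q F)`_k.
Proof.
move=> pr qh pq homF le_kd nzk F0.
have [bg sz] := pencil_graded pr qh homF.
exists d, (fun i => (pencil p q F)`_(d - i)), (d - k)%N; split=> //.
- by move=> i le_id; apply: bg; apply: subnK.
- rewrite -[LHS](sym_map_id (phi := p \+ q)) // -pencil_horner1 (horner_coef_wide _ sz).
  rewrite [RHS](reindex_inj rev_ord_inj) /=; apply: eq_bigr => i _.
  by rewrite expr1n mulr1 subSS subKn // -ltnS.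
- by rewrite leq_subr subKn.
move=> i /andP[lt_i le_id]; apply: F0.
by rewrite ltn_subLR // addnC -ltn_subLR.
Qed.

(** * Derivatives in constant directions *)

Section ConstantDerivation.
Variables (K : fieldType) (V W : vectType K).

(** With S(U) seen as the polynomial functions on the dual of U, this is the derivative in the
    constant direction [f]. *)
Definition cder (U : vectType K) (f : U -> K) : symalg U -> symalg U :=
  sym_der idfun (fun v => (f v)%:MP).

Lemma cder_derivation (U : vectType K) (f : U -> K) : derivation_along idfun (cder f).
Proof. exact: sym_der_derivation. Qed.

Lemma cder_inj (U : vectType K) (f : U -> K) (v : U) :
  scalar f -> cder f (sym_inj v) = (f v)%:MP.
Proof.
by move=> lin_f; apply: sym_der_inj => a u w /=; rewrite lin_f mpolyCD mpolyCM.
Qed.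

Lemma cder_coord (U : vectType K) k F : cder (coord (vbasis {:U}) k) F = F^`M(k).
Proof.
rewrite /cder /sym_der (bigD1 k) //= big1 => [|i ne_ik].
  by rewrite (tnth_nth 0) coord_free ?eqxx ?mpolyC1 ?mul1r ?addr0 // (basis_free (vbasisP _)).
rewrite (tnth_nth 0) coord_free ?(basis_free (vbasisP _)) //.
by rewrite [_ == _](negPf ne_ik) mpolyC0 mul0r.
Qed.

Lemma cderN (U : vectType K) (f : U -> K) F : cder (fun v => - f v) F = - cder f F.
Proof.
by rewrite /cder /sym_der -sumrN; apply: eq_bigr => i _; rewrite mpolyCN mulNr.
Qed.

Lemma cder_sym_map (phi : {linear V -> W}) (f : W -> K) (f' : V -> K) F :
  scalar f -> (forall v, f (phi v) = f' v) ->
  cder f (sym_map phi F) = sym_map phi (cder f' F).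
Proof.
move=> lin_f ff'; have lin_f' : scalar f'.
  by move=> a u v; rewrite -!ff' linearP lin_f.
move: F; apply: (symalg_derivation_eq
  (derivation_rmorph_comp (sym_mapC phi) (cder_derivation f))
  (derivation_comp_rmorph (sym_map phi) (cder_derivation f'))) => v /=.
by rewrite sym_map_inj !cder_inj // sym_mapC ff'.
Qed.

(** The coefficient of index 1 has exactly one factor taken through [q], and a direction vanishing
    on the image of [p] differentiates only that factor. *)
Lemma cder_pencil_coef1 (p q : {linear V -> W}) (f : W -> K) (f' : V -> K) F :
  scalar f -> (forall v, f (p v) = 0) -> (forall v, f (q v) = f' v) ->
  cder f (pencil p q F)`_1 = sym_map p (cder f' F).
Proof.
move=> lin_f fp0 fq; have lin_f' : scalar f'.
  by move=> a u v; rewrite -!fq linearP lin_f.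
have [fD fM _] := cder_derivation f.
have e : map_poly (cder f) \o pencil p q =1 (fun G => pencil p q (cder f' G) * 'X).
  apply: (symalg_derivation_eq (phi := pencil p q)).
  - exact: (map_derivation_along (cder_derivation f) (pencilC p q)).
  - by apply: derivation_mulr; apply: derivation_comp_rmorph; apply: cder_derivation.
  move=> v /=.
  rewrite pencil_inj (map_derivation_linear fD fM) !cder_inj // pencilC fp0 fq.
  by rewrite mpolyC0 polyC0 add0r.
have := congr1 (fun P : {poly symalg W} => P`_1) (e F) => /=.
rewrite (coef_map_derivation fD) => ->.
rewrite coefMX.
exact: pencil_coef0.
Qed.

End ConstantDerivation.

Lemma sym_map_comp_mpoly (K : fieldType) (V W : vectType K) (phi : {linear V -> W})
    m (E : m.-tuple (symalg V)) (Q : {mpoly K[m]}) :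
  sym_map phi (Q \mPo E) = Q \mPo [tuple sym_map phi (tnth E k) | k < m].
Proof.
move: Q; apply: (rmorph_mpoly_eq (f := sym_map phi \o comp_mpoly E)) => [c|k] /=.
  by rewrite !comp_mpolyC sym_mapC.
by rewrite !comp_mpolyXU -!tnth_nth tnth_mktuple.
Qed.

Lemma sym_invariant_comp (K : fieldType) (g : lieAlgType K) m
    (E : m.-tuple (symalg g)) (Q : {mpoly K[m]}) :
  (forall k, sym_invariant (tnth E k)) -> sym_invariant (Q \mPo E).
Proof.
move=> invE x; rewrite (derivation_comp (phi := idfun) (sym_ad_derivation x)).
by rewrite big1 // => j _; rewrite invE mul0r.
Qed.

(** * Components of the generators in the horospherical bigrading *)

Section Main.
Variables (K : fieldType) (g : lieAlgType K) (t : lieSubalg g).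
Hypothesis K0 : [pchar K] =i pred0.
Variables up um : {vspace g}.
Hypothesis tri : triangular_decomposition t up um.
Local Notation T := (lie_sub t).
Local Notation G := (gtilde t).
Local Notation l := (\dim {:T}).
Local Notation P := (proj_t t up um).
Local Notation c := (coord (vbasis {:T})).
Variable eps : K.
Hypothesis eps2 : eps * eps = 1.

Let nat2 : 2%:R != 0 :> K.
Proof. by have /pcharf0P -> := K0. Qed.

Let nz_eps : eps != 0.
Proof. by apply: contra_eq_neq eps2 => ->; rewrite mul0r eq_sym oner_eq0. Qed.

(** For non-zero [a] the image is [t0] when e = 1 and [t1] when e = -1. *)
Definition graph_t (e a : K) (s : T) : G := (a *: vsval s, (e * a) *: s).

Fact graph_t_linear e a : linear (graph_t e a).
Proof.
move=> x u v; apply/eqP; rewrite xpair_eqE /=.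
by apply/andP; split; apply/eqP; rewrite ?(linearP vsval) scalerDr !scalerA mulrC.
Qed.
HB.instance Definition _ e a := GRing.isLinear.Build K T G _ (graph_t e a) (graph_t_linear e a).

Definition fst_lin (v : G) : g := v.1.
Fact fst_lin_linear : linear fst_lin. Proof. by []. Qed.
HB.instance Definition _ := GRing.isLinear.Build K G g _ fst_lin fst_lin_linear.
Definition snd_lin (v : G) : T := v.2.
Fact snd_lin_linear : linear snd_lin. Proof. by []. Qed.
HB.instance Definition _ := GRing.isLinear.Build K G T _ snd_lin snd_lin_linear.

(** The missing factor 1/2 is the parameter [a] of [graph_t]; composing the two gives the
    projections onto the graphs of slopes [eps] and [- eps]. *)
Definition half_sum (e : K) (v : G) : T := P (fst_lin v) + e *: snd_lin v.
Fact half_sum_linear e : linear (half_sum e).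
Proof.
by move=> a u v; rewrite /half_sum !linearP scalerDr addrACA.
Qed.
HB.instance Definition _ e := GRing.isLinear.Build K G T _ (half_sum e) (half_sum_linear e).

Definition dir_t (e : K) (s : T) : G := e *: emb_dir s.
Fact dir_t_linear e : linear (dir_t e).
Proof. by move=> a u v; rewrite /dir_t linearP scalerDr !scalerA mulrC. Qed.
HB.instance Definition _ e := GRing.isLinear.Build K T G _ (dir_t e) (dir_t_linear e).

Lemma bold_f_scale d F : F \is d.-homog ->
  eps ^+ d *: bold_f t up um F = sym_map (dir_t eps) (restr_t t up um F).
Proof. by move=> homF; rewrite /bold_f -sym_map_scale //; apply: sym_map_homog. Qed.

Lemma half_sumD (U : lmodType K) (a b : U) :
  2%:R^-1 *: (a + b) + 2%:R^-1 *: (a - b) = a.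
Proof.
rewrite -scalerDr addrACA subrr addr0 scalerDr -scalerDl (_ : _ + _ = 1) ?scale1r //.
by apply: (mulIf nat2); rewrite mulrDl mulVf // mul1r.
Qed.

Lemma P_t (s : T) : P (vsval s) = s.
Proof. by apply: val_inj; apply: (proj_t_torus tri); apply: subvsP. Qed.

Lemma half_sum_graph (s : T) : half_sum eps (graph_t eps 2%:R^-1 s) = s.
Proof.
rewrite /half_sum /fst_lin /snd_lin /= linearZ /= P_t scalerA mulrA eps2 mul1r.
by have := half_sumD s 0; rewrite subr0 addr0.
Qed.

Lemma half_sumN_graphN (s : T) : half_sum (- eps) (graph_t (- eps) 2%:R^-1 s) = s.
Proof.
rewrite /half_sum /fst_lin /snd_lin /= linearZ /= P_t scalerA mulrA mulrNN eps2 mul1r.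
by have := half_sumD s 0; rewrite subr0 addr0.
Qed.

Lemma half_sumN_graph (s : T) : half_sum (- eps) (graph_t eps 2%:R^-1 s) = 0.
Proof.
rewrite /half_sum /fst_lin /snd_lin /= linearZ /= P_t scalerA mulrA mulNr eps2.
by rewrite mulN1r scaleNr subrr.
Qed.

Lemma half_sum_emb_g e x : half_sum e (emb_g t x) = P x.
Proof. by rewrite /half_sum /fst_lin /snd_lin /= scaler0 addr0. Qed.

Lemma half_sum_dir e e' s : half_sum e (dir_t e' s) = (e * e') *: s.
Proof. by rewrite /half_sum /fst_lin /snd_lin /= scaler0 linear0 add0r scalerA. Qed.

Section Projections.
Variables q u : {linear g -> g}.
Hypothesis split_g : forall v, v = u v + vsval (P v) + q v.
Hypothesis u_up : forall v, u v \in up.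
Hypothesis q_um : forall v, q v \in um.
Hypothesis lower : forall F, sym_invariant F ->
  sym_map ((vsval \o P) \+ q) F = sym_map (vsval \o P) F.

Let pi_r : {linear G -> G} :=
  (@emb_g K g t \o (q \o fst_lin)) \+ (graph_t eps 2%:R^-1 \o half_sum eps).
Let pi_h : {linear G -> G} :=
  (@emb_g K g t \o (u \o fst_lin)) \+ (graph_t (- eps) 2%:R^-1 \o half_sum (- eps)).

Lemma P_u v : P (u v) = 0.
Proof. by apply: (proj_t_roots tri); apply: (subvP (addvSl _ _)). Qed.
Lemma P_q v : P (q v) = 0.
Proof. by apply: (proj_t_roots tri); apply: (subvP (addvSr _ _)). Qed.
Let pi_sum : pi_r \+ pi_h =1 id.
Proof.
case=> x s; rewrite /pi_r /pi_h /= /half_sum /fst_lin /snd_lin /=.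
apply/eqP; rewrite xpair_eqE /=; apply/andP; split; apply/eqP.
  by rewrite addrACA scaleNr half_sumD [RHS]split_g -addrA addrC.
rewrite !add0r mulNr !scaleNr -scalerN opprB -!scalerA -scalerDr.
by rewrite [P x + _]addrC half_sumD scalerA eps2 scale1r.
Qed.

(** Fixes u_- and moves t to the graph of slope [eps]. Through it [pi_r] on g factors over the
    projection to t + u_-, the place where [lower] applies. *)
Let L : {linear g -> G} :=
  (@emb_g K g t \o (idfun \- (vsval \o P))) \+ (graph_t eps 2%:R^-1 \o P).

Let L_lower x : L (vsval (P x) + q x) = pi_r (emb_g t x).
Proof.
have eP : P (vsval (P x) + q x) = P x by rewrite linearD /= P_t P_q addr0.
rewrite /L /pi_r /= half_sum_emb_g eP.
by rewrite [vsval _ + q x]addrC addrK.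
Qed.

Let L_t s : L (vsval s) = graph_t eps 2%:R^-1 s.
Proof. by rewrite /L /= P_t subrr linear0 add0r. Qed.

Let sym_pi_r_emb F : sym_map pi_r (sym_emb_g t F) =
  sym_map L (sym_map ((vsval \o P) \+ q) F).
Proof.
rewrite /sym_emb_g !sym_map_comp; apply: eq_sym_map => x.
exact/esym/L_lower.
Qed.

Let sym_L_t (F : symalg T) : sym_map L (sym_map vsval F) = sym_map (graph_t eps 2%:R^-1) F.
Proof. by rewrite sym_map_comp; apply: eq_sym_map => s; apply: L_t. Qed.

Let sym_pi_r_inv F : sym_invariant F ->
  sym_map pi_r (sym_emb_g t F) = sym_map (graph_t eps 2%:R^-1) (restr_t t up um F).
Proof.
move=> invF; rewrite sym_pi_r_emb lower // -sym_L_t; congr (sym_map L _).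
by rewrite /restr_t sym_map_comp.
Qed.

Let pi_r_dir s : pi_r (dir_t eps s) = graph_t eps 2%:R^-1 s.
Proof.
rewrite /pi_r /= half_sum_dir eps2 scale1r.
by rewrite /fst_lin /= scaler0 !linear0 add0r.
Qed.

Let sym_pi_r_dir F : sym_map pi_r (sym_map (dir_t eps) F) = sym_map (graph_t eps 2%:R^-1) F.
Proof. by rewrite sym_map_comp; apply: eq_sym_map => s; apply: pi_r_dir. Qed.

Let gen (F : symalg g) : symalg G :=
  sym_emb_g t F - sym_map (dir_t eps) (restr_t t up um F).

Let sigma := pencil pi_r pi_h.

(** [pi_r] sends a vector of t and its [dir_t eps] copy to the same graph vector, so after [lower]
    the two terms coincide. *)
Lemma gen_coef0 F : sym_invariant F -> (sigma (gen F))`_0 = 0.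
Proof.
move=> invF; rewrite pencil_coef0 /gen rmorphB /= sym_pi_r_inv // sym_pi_r_dir.
exact: subrr.
Qed.

(** Coordinates on the graph of slope [- eps]; they vanish on the image of [pi_r], as
    [cder_pencil_coef1] requires. *)
Let delta (k : 'I_l) (v : G) : K := c k (half_sum (- eps) v).

Let delta_scalar k : scalar (delta k).
Proof. by move=> a x y; rewrite /delta !linearP. Qed.

Let half_sumN_pi_r v : half_sum (- eps) (pi_r v) = 0.
Proof. by rewrite /pi_r /= linearD /= half_sum_emb_g P_q half_sumN_graph addr0. Qed.

Let half_sumN_pi_h v : half_sum (- eps) (pi_h v) = half_sum (- eps) v.
Proof. by rewrite /pi_h /= linearD /= half_sum_emb_g P_u half_sumN_graphN add0r. Qed.

(** The factor 2 is the sum of two equal contributions: [delta k] is the k-th coordinate on t and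
    minus that coordinate on the [dir_t eps] copy, and the second sign cancels the one in [gen]. *)
Lemma delta_gen_coef1 k F : sym_invariant F ->
  cder (delta k) (sigma (gen F))`_1 =
  sym_map (graph_t eps 2%:R^-1) ((restr_t t up um F)^`M(k)) *+ 2.
Proof.
move=> invF.
rewrite (cder_pencil_coef1 (f' := delta k)) //; last first.
- by move=> v; rewrite /delta half_sumN_pi_h.
- by move=> v; rewrite /delta half_sumN_pi_r linear0.
pose e x := c k (P x).
have e_scalar : scalar e by move=> a x y; rewrite /e !linearP.
have [dD dM dC] := cder_derivation (delta k).
have cderB F1 F2 : cder (delta k) (F1 - F2) = cder (delta k) F1 - cder (delta k) F2.
  by apply: (addIr (cder (delta k) F2)); rewrite -dD !subrK.
rewrite /gen cderB rmorphB /= /sym_emb_g.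
rewrite (cder_sym_map (f' := e)) //; last first.
  by move=> x; rewrite /delta half_sum_emb_g.
rewrite (cder_sym_map (f' := fun s => - c k s)) //; last first.
  by move=> s; rewrite /delta half_sum_dir mulNr eps2 scaleN1r linearN.
rewrite cderN cder_coord !rmorphN /= opprK sym_pi_r_dir.
(* The derivative of F need not be invariant, so it is first moved outside the projection to t +
   u_-; then [lower] can be applied to F itself. *)
rewrite [sym_map pi_r _]sym_pi_r_emb -(cder_sym_map (f := e)) //; last first.
  by move=> x; rewrite /e /= linearD /= P_t P_q addr0.
rewrite lower //; have -> : sym_map (vsval \o P) F = sym_map vsval (restr_t t up um F).
  by rewrite /restr_t sym_map_comp.
rewrite (cder_sym_map (f' := c k)) //; last by move=> s; rewrite /e P_t.
by rewrite cder_coord sym_L_t mulr2n.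
Qed.

Let delta' (k : 'I_l) (v : G) : K := c k (half_sum eps v).

Lemma dir_coef0 s : (sigma (sym_inj (emb_dir s)))`_0 = sym_inj (graph_t eps 2%:R^-1 (eps *: s)).
Proof.
rewrite pencil_coef0 sym_map_inj; congr sym_inj.
rewrite -pi_r_dir; congr (pi_r _).
by rewrite /dir_t linearZ /= scalerA eps2 scale1r.
Qed.

Lemma delta_dir_coef0 k s : cder (delta k) (sigma (sym_inj (emb_dir s)))`_0 = 0.
Proof. by rewrite dir_coef0 cder_inj // /delta half_sumN_graph linear0 mpolyC0. Qed.

Lemma delta'_dir_coef0 k s :
  cder (delta' k) (sigma (sym_inj (emb_dir s)))`_0 = (c k (eps *: s))%:MP.
Proof.
rewrite dir_coef0 cder_inj /delta' ?half_sum_graph //.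
by move=> a x y; rewrite /delta' !linearP.
Qed.


Section Components.
Variables (F : l.-tuple (symalg g)) (d : 'I_l -> nat) (xi : l.-tuple T).
Hypothesis F_inv : forall j, sym_invariant (tnth F j).
Hypothesis F_deg : forall j, tnth F j \is (d j).-homog.
Hypothesis nz_jac : \det (\matrix_(k, j) (restr_t t up um (tnth F j))^`M(k)) != 0.
Hypothesis nz_xi : \det (\matrix_(k, i) c k (eps *: tnth xi i)) != 0.
Variables h r : {vspace G}.
Hypothesis r_pi : forall v, pi_r v \in r.
Hypothesis h_pi : forall v, pi_h v \in h.

Let B0 := [tuple (sigma (sym_inj (emb_dir (tnth xi i))))`_0 | i < l].
Let B1 := [tuple (sigma (gen (tnth F j)))`_1 | j < l].

Let sym_graph_inj (H : symalg T) : sym_map (graph_t eps 2%:R^-1) H = 0 -> H = 0.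
Proof.
move=> H0; have := congr1 (sym_map (half_sum eps)) H0.
by rewrite sym_map_comp rmorph0 sym_map_id // => s; apply: half_sum_graph.
Qed.

Lemma components_independent : alg_independent (cat_tuple B0 B1).
Proof.
apply: (block_independent K0 (D1 := fun k => cder (delta' k))
  (D2 := fun k => cder (delta k)) _ _ nz_xi).
- by move=> k; apply: cder_derivation.
- by move=> k; apply: cder_derivation.
- by move=> k i; rewrite tnth_mktuple delta'_dir_coef0 mxE.
- by move=> k i; rewrite tnth_mktuple delta_dir_coef0.
(* This is twice the Jacobian matrix of the f_j carried over by [graph_t], an injective transport
   since [half_sum eps] is a retraction. *)
rewrite (_ : \matrix_(k, j) _ = 2%:R *: map_mx (sym_map (graph_t eps 2%:R^-1))
    (\matrix_(k, j) (restr_t t up um (tnth F j))^`M(k))).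
  rewrite detZ det_map_mx mulf_neq0 ?expf_neq0 ?natr_mpoly_eq0 //.
  by apply: contraNneq nz_jac => /sym_graph_inj ->.
apply/matrixP => k j; rewrite !mxE tnth_mktuple delta_gen_coef1 //.
by rewrite mulr_natl.
Qed.

Lemma gen_homog j : gen (tnth F j) \is (d j).-homog.
Proof. by rewrite /gen rpredB // !sym_map_homog. Qed.

Lemma dir_homog s : sym_inj (emb_dir s : G) \is 1.-homog.
Proof. exact: sym_inj_homog. Qed.

Lemma components_max k : max_component h r
  (tnth (cat_tuple [tuple sym_inj (emb_dir (tnth xi i)) | i < l]
                   [tuple gen (tnth F j) | j < l]) k)
  (tnth (cat_tuple B0 B1) k).
Proof.
have nzT := alg_independent_neq0 _ components_independent.
case: (split_ordP k) => i ->.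
  have := nzT (lshift l i); rewrite !tnth_lshift !tnth_mktuple => nz.
  exact: (max_component_pencil r_pi h_pi pi_sum (dir_homog _)).
have := nzT (rshift l i); rewrite !tnth_rshift !tnth_mktuple => nz.
have [_ sz] := pencil_graded r_pi h_pi (gen_homog i).
apply: (max_component_pencil r_pi h_pi pi_sum (gen_homog i)) => //.
  (* In degree 0 the index 1 would lie beyond the size of the pencil and the component would be
     zero. *)
  rewrite lt0n; apply: contraNneq nz => d0.
  by rewrite nth_default // (leq_trans sz) // d0.
by case=> // _; apply: gen_coef0.
Qed.

End Components.

End Projections.
End Main.

(** * Generation of the invariants of the extended algebra *)

Section Generation.
Variables (K : fieldType) (n m : nat).
Variable E : m.-tuple {mpoly K[n]}.

Definition generated (H : {mpoly K[n]}) : Prop := exists Q : {mpoly K[m]}, H = Q \mPo E.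

Lemma generatedC a : generated a%:MP.
Proof. by exists a%:MP; rewrite comp_mpolyC. Qed.
Lemma generatedD H1 H2 : generated H1 -> generated H2 -> generated (H1 + H2).
Proof. by move=> [Q1 ->] [Q2 ->]; exists (Q1 + Q2); rewrite rmorphD. Qed.
Lemma generatedM H1 H2 : generated H1 -> generated H2 -> generated (H1 * H2).
Proof. by move=> [Q1 ->] [Q2 ->]; exists (Q1 * Q2); rewrite rmorphM. Qed.
Lemma generatedE k : generated (tnth E k).
Proof. by exists 'X_k; rewrite comp_mpolyXU -tnth_nth. Qed.
Lemma generatedZ a H : generated H -> generated (a *: H).
Proof. by rewrite -mul_mpolyC; apply: generatedM; apply: generatedC. Qed.
Lemma generated_sum I (s : seq I) (P : pred I) (H : I -> {mpoly K[n]}) :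
  (forall i, P i -> generated (H i)) -> generated (\sum_(i <- s | P i) H i).
Proof. by apply: big_ind; [rewrite -mpolyC0; apply: generatedC | apply: generatedD]. Qed.
Lemma generated_prod I (s : seq I) (P : pred I) (H : I -> {mpoly K[n]}) :
  (forall i, P i -> generated (H i)) -> generated (\prod_(i <- s | P i) H i).
Proof. by apply: big_ind; [rewrite -mpolyC1; apply: generatedC | apply: generatedM]. Qed.
Lemma generatedX H e : generated H -> generated (H ^+ e).
Proof.
move=> genH; elim: e => [|e IHe]; first by rewrite expr0 -mpolyC1; apply: generatedC.
by rewrite exprS; apply: generatedM.
Qed.

Lemma generated_comp k (H : k.-tuple {mpoly K[n]}) (Q : {mpoly K[k]}) :
  (forall i, generated (tnth H i)) -> generated (Q \mPo H).
Proof.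
move=> genH; move: Q; apply: mpoly_gen_ind => [a|i|Q1 Q2 g1 g2|Q1 Q2 g1 g2].
- by rewrite comp_mpolyC; apply: generatedC.
- by rewrite comp_mpolyXU -tnth_nth.
- by rewrite rmorphD; apply: generatedD.
- by rewrite rmorphM; apply: generatedM.
Qed.

End Generation.

Section Expansion.
Variables (K : fieldType) (g : lieAlgType K) (t : lieSubalg g).
Local Notation T := (lie_sub t).
Local Notation G := (gtilde t).
Local Notation l := (\dim {:T}).
Local Notation c := (coord (vbasis {:T})).
Local Notation R := (symalg g).

(* S(g + t_dir) as polynomials over S(g) in the coordinates of t_dir. *)
Definition expand_const : {rmorphism K -> {mpoly R[l]}} :=
  GRing.RMorphism.clone _ _ (@mpolyC l R \o @mpolyC (\dim {:g}) K) _.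

Definition expand_gen (v : G) : {mpoly R[l]} :=
  (sym_inj v.1)%:MP + \sum_k (c k v.2)%:MP *: 'X_k.

Definition expand : symalg G -> {mpoly R[l]} := sym_ext expand_const expand_gen.
HB.instance Definition _ := GRing.RMorphism.copy expand (sym_ext _ expand_gen).

Lemma expandC a : expand a%:MP = (a%:MP)%:MP.
Proof. exact: sym_extC. Qed.

Lemma expand_inj v : expand (sym_inj v) = expand_gen v.
Proof.
apply: sym_ext_inj => a u w; rewrite /expand_gen /=.
rewrite linearP /= mpolyCD -mul_mpolyC mpolyCM mulrDr -!addrA; congr (_ + _).
rewrite addrCA; congr (_ + _); rewrite mulr_sumr -big_split; apply: eq_bigr => k _ /=.
by rewrite linearP mpolyCD mpolyCM scalerDl -scalerA mul_mpolyC.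
Qed.

Definition collect : {mpoly R[l]} -> symalg G :=
  mmap (sym_map (@emb_g K g t)) (fun k => sym_inj (emb_dir (tnth (vbasis {:T}) k))).
HB.instance Definition _ := GRing.RMorphism.copy collect (mmap (sym_map (@emb_g K g t)) _).

Lemma collectC F : collect F%:MP = sym_emb_g t F.
Proof. exact: mmapC. Qed.

Lemma collectZ F Q : collect (F *: Q) = sym_emb_g t F * collect Q.
Proof. exact: mmapZ. Qed.

Lemma collectX k : collect 'X_k = sym_inj (emb_dir (tnth (vbasis {:T}) k)).
Proof. by rewrite /collect mmapX mmap1U. Qed.

Lemma expandK : cancel expand collect.
Proof.
apply: (symalg_rmorph_eq (f := collect \o expand) (g := idfun)) => [a|v] /=.
  rewrite expandC collectC; exact: sym_mapC.
transitivity (sym_emb_g t (sym_inj v.1) +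
    \sum_k sym_emb_g t (c k v.2)%:MP * sym_inj (emb_dir (tnth (vbasis {:T}) k))).
  rewrite expand_inj rmorphD [X in _ + X]rmorph_sum; congr (_ + _); first exact: collectC.
  by apply: eq_bigr => k _; rewrite -collectX; apply: collectZ.
transitivity (sym_inj (emb_g t v.1 + emb_dir v.2)); last first.
  by case: v => x s; congr sym_inj; apply/eqP; rewrite xpair_eqE /= addr0 add0r !eqxx.
rewrite /sym_emb_g sym_map_inj linearD; congr (_ + _).
rewrite [in RHS](coord_vbasis (memvf v.2)) !linear_sum.
apply: eq_bigr => k _; rewrite sym_mapC mul_mpolyC.
by rewrite -tnth_nth !linearZ.
Qed.

Lemma lie_emb_g x v : lie (emb_g t x) v = emb_g t (lie x v.1).
Proof.
by apply/eqP; rewrite xpair_eqE /= eqxx; apply/eqP; apply: lie0l.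
Qed.

Lemma expand_emb_g y : expand (sym_inj (emb_g t y)) = (sym_inj y)%:MP.
Proof.
rewrite expand_inj /expand_gen [X in _ + X]big1 ?addr0 // => k _.
by rewrite linear0 mpolyC0 scale0r.
Qed.

(** Bracketing with an element of g kills t_dir, so its action passes to the coefficients. *)
Lemma expand_sym_ad x H m :
  (expand (sym_ad (emb_g t x) H))@_m = sym_ad x ((expand H)@_m).
Proof.
have [aD aM aC] := sym_ad_derivation x; have [bD bM bC] := sym_ad_derivation (emb_g t x).
have a0 : sym_ad x 0 = 0 by rewrite -mpolyC0 aC.
have a_sum I (s : seq I) (P : pred I) (f : I -> R) :
    sym_ad x (\sum_(i <- s | P i) f i) = \sum_(i <- s | P i) sym_ad x (f i).
  exact: (big_morph _ aD a0).
have aMn (f : R) (b : bool) : sym_ad x (f * b%:R) = sym_ad x f * b%:R.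
  by case: b; rewrite ?mulr1 ?mulr0.
have eD H1 H2 : expand (H1 + H2) = expand H1 + expand H2 := rmorphD _ _ _.
have eM H1 H2 : expand (H1 * H2) = expand H1 * expand H2 := rmorphM _ _ _.
have mD k (p1 p2 : {mpoly R[l]}) : (p1 + p2)@_k = p1@_k + p2@_k by exact: mcoeffD.
have mM k (p1 p2 : {mpoly R[l]}) := mcoeffM p1 p2 k.
move: H m; apply: symalg_ind => [a|v|H1 H2 e1 e2|H1 H2 e1 e2] m.
- by rewrite bC rmorph0 mcoeff0 expandC mcoeffC aMn aC mul0r.
- rewrite sym_ad_inj lie_emb_g expand_emb_g expand_inj /expand_gen mcoeffD aD !mcoeffC.
  rewrite aMn sym_ad_inj [X in sym_ad x X]raddf_sum a_sum [X in _ + X]big1 ?addr0 // => k _.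
  by rewrite /= mcoeffZ mcoeffX aMn aC mul0r.
- transitivity ((expand (sym_ad (emb_g t x) H1))@_m + (expand (sym_ad (emb_g t x) H2))@_m).
    rewrite bD eD; exact: mD.
  transitivity (sym_ad x ((expand H1)@_m) + sym_ad x ((expand H2)@_m)).
    exact: (congr2 _ (e1 m) (e2 m)).
  transitivity (sym_ad x ((expand H1)@_m + (expand H2)@_m)).
    exact: (esym (aD _ _)).
  apply: (congr1 (sym_ad x)).
  rewrite eD.
  exact/esym/mD.
transitivity ((expand (sym_ad (emb_g t x) H1) * expand H2)@_m
   + (expand H1 * expand (sym_ad (emb_g t x) H2))@_m).
  rewrite bM eD (eM (sym_ad _ H1)) eM; exact: mD.
transitivity (sym_ad x ((expand H1 * expand H2)@_m)); last first.
  exact: (congr1 (fun z => sym_ad x (z@_m)) (esym (eM H1 H2))).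
apply: etrans (congr2 +%R (mM m (expand (sym_ad _ H1)) (expand H2))
  (mM m (expand H1) (expand (sym_ad _ H2)))) _.
apply/esym; apply: etrans (congr1 (sym_ad x) (mM m (expand H1) (expand H2))) _.
rewrite a_sum -big_split; apply: eq_bigr => i _.
apply: etrans (aM _ _) _.
exact: (congr2 (fun z1 z2 => z1 * (expand H2)@_i.2 + (expand H1)@_i.1 * z2)
  (esym (e1 _)) (esym (e2 _))).
Qed.

Lemma expand_invariant H m : sym_invariant H -> sym_invariant ((expand H)@_m).
Proof. by move=> invH x; rewrite -expand_sym_ad invH rmorph0 mcoeff0. Qed.

End Expansion.

Section Hilbert.
Variables (K : fieldType) (g : lieAlgType K) (t : lieSubalg g).
Hypothesis K0 : [pchar K] =i pred0.
Hypothesis g_reductive : reductive g.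
Hypothesis t_nilpotent : lie_nilpotent t.
Variables up um : {vspace g}.
Hypothesis tri : triangular_decomposition t up um.
Local Notation T := (lie_sub t).
Local Notation G := (gtilde t).
Local Notation l := (\dim {:T}).
Local Notation P := (proj_t t up um).
Local Notation c := (coord (vbasis {:T})).
Variable eps : K.

Variables (F : l.-tuple (symalg g)) (d : 'I_l -> nat) (xi : l.-tuple T).
Hypothesis F_hilbert : hilbert_basis F.
Hypothesis F_deg : forall j, tnth F j \is (d j).-homog.
Hypothesis xi_basis : basis_of {:T} xi.

Let F_inv j : sym_invariant (tnth F j). Proof. by case: F_hilbert => inv _ _ _; apply: inv. Qed.

Lemma restr_independent (Q : {mpoly K[l]}) :
  Q \mPo [tuple restr_t t up um (tnth F j) | j < l] = 0 -> Q = 0.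
Proof.
move=> QF; have [_ _ indF _] := F_hilbert; apply: indF.
apply: (chevalley_injective K0 g_reductive t_nilpotent tri).
  exact: sym_invariant_comp.
by rewrite /restr_t sym_map_comp_mpoly.
Qed.

Lemma restr_jacobian_neq0 :
  \det (\matrix_(k, j) (restr_t t up um (tnth F j))^`M(k)) != 0.
Proof.
have := jacobian_neq0 K0 restr_independent; congr (\det _ != 0).
by apply/matrixP => k j; rewrite !mxE tnth_mktuple.
Qed.

Lemma basis_jacobian_neq0 e : e != 0 -> \det (\matrix_(k, i) c k (e *: tnth xi i)) != 0.
Proof.
move=> nze; apply: contra_neq (expf_neq0 l nze) => det0.
have : (\matrix_(i, k) coord xi i (vbasis {:T})`_k) *m
    (\matrix_(k, i) c k (e *: tnth xi i)) = e%:M.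
  apply/matrixP => i j; rewrite !mxE.
  transitivity (coord xi i (e *: tnth xi j)); last first.
    by rewrite linearZ /= (tnth_nth 0) coord_free ?(basis_free xi_basis) // mulr_natr eq_sym.
  rewrite [in RHS](coord_vbasis (memvf (e *: tnth xi j))) linear_sum.
  by apply: eq_bigr => k _; rewrite !mxE [RHS]linearZ /= mulrC.
by move/(congr1 determinant); rewrite det_mulmx det0 mulr0 det_scalar => <-.
Qed.

Let gen (H : symalg g) : symalg G :=
  sym_emb_g t H - sym_map (dir_t eps) (restr_t t up um H).

Lemma lie_sub_abelian (a b : T) : lie a b = 0.
Proof.
apply: val_inj; rewrite [LHS]val_lie_sub_lie /=.
by rewrite (torus_abelian g_reductive t_nilpotent tri) ?subvsP.
Qed.

Lemma sym_ad_dir_t e v (H : symalg T) : sym_ad v (sym_map (@dir_t K g t e) H) = 0.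
Proof.
move: H; apply: (symalg_derivation_eq
  (derivation_rmorph_comp (sym_mapC _) (sym_ad_derivation v)) (derivation_zero _)) => s /=.
rewrite sym_map_inj sym_ad_inj (_ : lie v _ = 0) ?linear0 //.
apply/eqP; rewrite xpair_eqE /= scaler0 lie0r eqxx; apply/eqP; exact: lie_sub_abelian.
Qed.

Lemma sym_ad_emb_g v H : sym_ad v (sym_emb_g t H) = sym_emb_g t (sym_ad v.1 H).
Proof.
move: H; apply: (symalg_derivation_eq
  (derivation_rmorph_comp (sym_mapC (@emb_g K g t)) (sym_ad_derivation v))
  (derivation_comp_rmorph (sym_map (@emb_g K g t)) (sym_ad_derivation v.1))) => x /=.
rewrite sym_map_inj !sym_ad_inj sym_map_inj; congr sym_inj.
by apply/eqP; rewrite xpair_eqE /= eqxx; apply/eqP; apply: lie0r.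
Qed.

Lemma gen_invariant H : sym_invariant H -> sym_invariant (gen H).
Proof.
move=> invH v; have [aD _ _] := sym_ad_derivation v.
apply: (addIr (sym_ad v (sym_map (dir_t eps) (restr_t t up um H)))).
rewrite -aD subrK sym_ad_dir_t addr0 sym_ad_emb_g invH.
exact: rmorph0.
Qed.

Let E := cat_tuple [tuple sym_inj (emb_dir (tnth xi i)) | i < l] [tuple gen (tnth F j) | j < l].

(** Derivatives along t_dir test the xi_i, derivatives along t the remaining generators. The latter
    kill S(t_dir), and restricting the resulting block to t gives the Jacobian matrix of the f_j. *)
Lemma gens_independent : alg_independent E.
Proof.
have nzX := basis_jacobian_neq0 (oner_neq0 K).
pose f1 k (v : G) := c k (snd_lin v); pose f2 k (v : G) := c k (P (fst_lin v)).
have f1_scalar k : scalar (f1 k) by move=> a x y; rewrite /f1 !linearP.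
have f2_scalar k : scalar (f2 k) by move=> a x y; rewrite /f2 !linearP.
apply: (block_independent K0 (D1 := fun k => cder (f1 k)) (D2 := fun k => cder (f2 k)) _ _ nzX).
- by move=> k; apply: cder_derivation.
- by move=> k; apply: cder_derivation.
- by move=> k i; rewrite tnth_mktuple cder_inj // mxE scale1r.
- move=> k i; rewrite tnth_mktuple cder_inj //.
  by rewrite /f2 /fst_lin /= !linear0 mpolyC0.
apply: contraNneq restr_jacobian_neq0 => det0.
have := congr1 (sym_map (P \o @fst_lin K g t)) det0; rewrite rmorph0 -det_map_mx => e0.
apply/eqP; apply: etrans _ e0.
congr (\det _); apply/matrixP => k j; rewrite !mxE tnth_mktuple /gen.
have [fD _ _] := cder_derivation (f2 k).
have -> : cder (f2 k) (sym_emb_g t (tnth F j) -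
    sym_map (dir_t eps) (restr_t t up um (tnth F j))) =
    sym_emb_g t (cder (fun x => c k (P x)) (tnth F j)).
  apply: (addIr (cder (f2 k) (sym_map (dir_t eps) (restr_t t up um (tnth F j))))).
  rewrite -fD subrK [X in _ = _ + X](cder_sym_map (f' := fun=> 0)) //; last first.
    by move=> s; rewrite /f2 /fst_lin /= scaler0 !linear0.
  rewrite (cder_sym_map (f' := fun x => c k (P x))) //.
  rewrite -[LHS]addr0; congr (_ + _).
  rewrite -[LHS](rmorph0 (sym_map (dir_t eps))); congr (sym_map _ _).
  by rewrite /cder /sym_der big1 // => i _; rewrite mpolyC0 mul0r.
rewrite -cder_coord /restr_t (cder_sym_map (f' := fun x => c k (P x))) //; last first.
  by move=> a x y; rewrite linearP.
rewrite /sym_emb_g /= [RHS]sym_map_comp.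
exact: eq_sym_map.
Qed.

(** The coefficients of [H] in the coordinates of t_dir are polynomials in the F_j, and each F_j is
    a proposed generator plus an element of S(t_dir). *)
Lemma gens_generate H : sym_invariant H -> generated E H.
Proof.
move=> invH; rewrite -[H](expandK (t := t)).
have gen_dir s : generated E (sym_inj (emb_dir s)).
  rewrite (coord_basis xi_basis (memvf s)) !linear_sum; apply: generated_sum => i _.
  rewrite !linearZ /=; apply: generatedZ.
  have -> : sym_inj (emb_dir xi`_i) = tnth E (lshift l i).
    by rewrite tnth_lshift tnth_mktuple (tnth_nth 0).
  exact: generatedE.
have gen_map (H' : symalg T) : generated E (sym_map (dir_t eps) H').
  move: H'; apply: symalg_ind => [a|s|H1 H2 g1 g2|H1 H2 g1 g2].
  - by rewrite sym_mapC; apply: generatedC.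
  - by rewrite sym_map_inj /= /dir_t linearZ /=; apply: generatedZ; apply: gen_dir.
  - by rewrite rmorphD; apply: generatedD.
  - by rewrite rmorphM; apply: generatedM.
have gen_F j : generated E (sym_emb_g t (tnth F j)).
  rewrite -[sym_emb_g t _](subrK (sym_map (dir_t eps) (restr_t t up um (tnth F j)))).
  apply: generatedD => //.
  have -> : sym_emb_g t (tnth F j) - sym_map (dir_t eps) (restr_t t up um (tnth F j)) =
      tnth E (rshift l j).
    by rewrite tnth_rshift tnth_mktuple.
  exact: generatedE.
rewrite /collect /mmap; apply: generated_sum => m _; apply: generatedM; last first.
  by apply: generated_prod => k _; apply: generatedX.
have [_ _ _ genF] := F_hilbert.
have [Q ->] := genF _ (expand_invariant m invH).
rewrite sym_map_comp_mpoly; apply: generated_comp => k.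
by rewrite tnth_mktuple; apply: gen_F.
Qed.

Lemma gens_hilbert : hilbert_basis E.
Proof.
split.
- move=> k; case: (split_ordP k) => i ->; rewrite ?tnth_lshift ?tnth_rshift tnth_mktuple.
    move=> v; rewrite sym_ad_inj (_ : lie v _ = 0) ?linear0 //.
    by apply/eqP; rewrite xpair_eqE /= lie0r eqxx; apply/eqP; apply: lie_sub_abelian.
  exact: gen_invariant.
- move=> k; case: (split_ordP k) => i ->; rewrite ?tnth_lshift ?tnth_rshift tnth_mktuple.
    by exists 1%N; apply: sym_inj_homog.
  by exists (d i); rewrite /gen rpredB // !sym_map_homog.
- exact: gens_independent.
- by move=> H /gens_generate.
Qed.

(** The subspaces enter only through these memberships, so the same statement serves [htilde],
    [rtilde] with eps = 1 and the exchanged pair with eps = -1. *)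
Lemma scaled_good_system (h r : {vspace G}) : eps * eps = 1 ->
  (forall v, v \in up -> emb_g t v \in h) ->
  (forall s a, graph_t (- eps) a s \in h) ->
  (forall v, v \in um -> emb_g t v \in r) ->
  (forall s a, graph_t eps a s \in r) ->
  good_generating_system h r E.
Proof.
move=> eps2 h_up h_t r_um r_t; split; first exact: gens_hilbert.
have [q [u [split_g u_up q_um lower]]] := opposite_borel K0 g_reductive t_nilpotent tri.
have nz_eps : eps != 0 by apply: contra_eq_neq eps2 => ->; rewrite mul0r eq_sym oner_eq0.
eexists; split.
  apply: (components_max K0 tri eps2 split_g u_up q_um lower F_inv F_deg restr_jacobian_neq0
    (basis_jacobian_neq0 nz_eps)).
  - by move=> v /=; apply: memvD; [apply: r_um | apply: r_t].
  - by move=> v /=; apply: memvD; [apply: h_up | apply: h_t].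
exact: (components_independent K0 tri eps2 u_up q_um lower F_inv restr_jacobian_neq0
    (basis_jacobian_neq0 nz_eps)).
Qed.

End Hilbert.

(** * The two horospherical splittings *)

Lemma restr_tC (K : fieldType) (g : lieAlgType K) (t : lieSubalg g)
    (up um : {vspace g}) : restr_t t up um =1 restr_t t um up.
Proof. by move=> F; apply: eq_sym_map => x; rewrite /proj_t addvC. Qed.

Section HorosphericalSpaces.
Variables (K : fieldType) (g : lieAlgType K) (t : lieSubalg g) (u : {vspace g}).

Lemma emb_g_htilde v : v \in u -> emb_g t v \in htilde t u.
Proof.
move=> vu; apply: (subvP (addvSl _ _)).
by have := memv_img (linfun (@emb_g K g t)) vu; rewrite lfunE.
Qed.

Lemma emb_g_rtilde v : v \in u -> emb_g t v \in rtilde t u.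
Proof.
move=> vu; apply: (subvP (addvSl _ _)).
by have := memv_img (linfun (@emb_g K g t)) vu; rewrite lfunE.
Qed.

Lemma graph_htilde s a : graph_t (t := t) (-1) a s \in htilde t u.
Proof.
apply: (subvP (addvSr _ _)).
have -> : graph_t (-1) a s = linfun (@antidiag_t K g t) (a *: s).
  rewrite lfunE; apply/eqP; rewrite xpair_eqE /= mulN1r scaleNr.
  by rewrite !eqxx.
exact: memv_img (memvf _).
Qed.

Lemma graph_rtilde s a : graph_t (t := t) 1 a s \in rtilde t u.
Proof.
apply: (subvP (addvSr _ _)).
have -> : graph_t 1 a s = linfun (@diag_t K g t) (a *: s).
  by rewrite lfunE; apply/eqP; rewrite xpair_eqE /= mul1r !eqxx.
exact: memv_img (memvf _).
Qed.

End HorosphericalSpaces.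

Theorem proposition5p2
  (K : closedFieldType) (K_char0 : [pchar K] =i pred0)
  (g : lieAlgType K) (g_reductive : reductive g)
  (t : lieSubalg g) (t_cartan : cartan_subalgebra t)
  (l : nat) (rank_l : \dim t = l)
  (up um : {vspace g}) (tri : triangular_decomposition t up um)
  (F : l.-tuple (symalg g)) (F_hilbert : hilbert_basis F)
  (d : 'I_l -> nat) (F_deg : forall j, tnth F j \is (d j).-homog)
  (xi : l.-tuple (lie_sub t)) (xi_basis : basis_of {:lie_sub t} xi) :
  good_generating_system (htilde t up) (rtilde t um)
    (cat_tuple
       [tuple sym_inj (emb_dir (tnth xi j)) | j < l]
       [tuple sym_emb_g t (tnth F j) - bold_f t up um (tnth F j) | j < l])
  /\
  good_generating_system (rtilde t um) (htilde t up)
    (cat_tuple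
       [tuple sym_inj (emb_dir (tnth xi j)) | j < l]
       [tuple sym_emb_g t (tnth F j)
                - (-1) ^+ d j *: bold_f t up um (tnth F j) | j < l]).
Proof.
have [t_nil _] := t_cartan.
have dimT : l = \dim {:lie_sub t} by rewrite -rank_l dimvf.
clear rank_l; subst l.
have tri' := triangular_decomposition_sym K_char0 g_reductive t_nil tri.
split.
- have e j : bold_f t up um (tnth F j) = sym_map (dir_t 1) (restr_t t up um (tnth F j)).
    by rewrite -(@bold_f_scale _ _ _ up um 1 _ _ (F_deg j)) expr1n scale1r.
  have -> : [tuple sym_emb_g t (tnth F j) - bold_f t up um (tnth F j)
      | j < \dim {:lie_sub t}] =
    [tuple sym_emb_g t (tnth F j) - sym_map (dir_t 1) (restr_t t up um (tnth F j))
      | j < \dim {:lie_sub t}].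
    apply: eq_mktuple => j.
    exact: (congr1 (fun H => sym_emb_g t (tnth F j) - H) (e j)).
  apply: (scaled_good_system K_char0 g_reductive t_nil tri F_hilbert F_deg xi_basis).
  + by rewrite mulr1.
  + exact: emb_g_htilde.
  + exact: graph_htilde.
  + exact: emb_g_rtilde.
  + exact: graph_rtilde.
have e j : (-1) ^+ d j *: bold_f t up um (tnth F j) =
    sym_map (dir_t (-1)) (restr_t t um up (tnth F j)).
  by rewrite -(@bold_f_scale _ _ _ um up (-1) _ _ (F_deg j)) /bold_f restr_tC.
have -> : [tuple sym_emb_g t (tnth F j) - (-1) ^+ d j *: bold_f t up um (tnth F j)
      | j < \dim {:lie_sub t}] =
    [tuple sym_emb_g t (tnth F j) - sym_map (dir_t (-1)) (restr_t t um up (tnth F j))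
      | j < \dim {:lie_sub t}].
  apply: eq_mktuple => j.
  exact: (congr1 (fun H => sym_emb_g t (tnth F j) - H) (e j)).
apply: (scaled_good_system K_char0 g_reductive t_nil tri' F_hilbert F_deg xi_basis).
- by rewrite mulrNN mulr1.
- exact: emb_g_rtilde.
- by rewrite opprK; apply: graph_rtilde.
- exact: emb_g_htilde.
- exact: graph_htilde.
Qed.
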